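(* Let $n \ge 2$ and $G = \mathbb{R}^n \setminus \{0\}$. Let $\kappa$ denote the (unique) solution $p = \kappa$ in $[1,\pi]$ of the equation $$\cos\sqrt{p^2-1} + \sqrt{p^2-1}\,\sin\sqrt{p^2-1} = e^{-1},$$ which has the numerical approximation $\kappa \approx 2.83297$. Then: 1) For every $x \in \mathbb{R}^n\setminus\{0\}$ the quasihyperbolic ball $D_{\mathbb{R}^n\setminus\{0\}}(x,M)$ is strictly convex for $M \in (0,1]$, and it is not convex for $M > 1$. 2) For every $x \in \mathbb{R}^n\setminus\{0\}$ the quasihyperbolic ball $D_{\mathbb{R}^n\setminus\{0\}}(x,M)$ is strictly starlike with respect to $x$ for $M \in (0,\kappa]$, and it is not starlike with respect to $x$ for $M > \kappa$.
   Context: For a proper subdomain $G$ of $\mathbb{R}^n$, $n\ge 2$ (a domain is a nonempty open connected set), the quasihyperbolic distance between $x,y\in G$ is $$k_G(x,y) = \inf_{\alpha \in \Gamma_{xy}} \int_\alpha \frac{|dz|}{d(z,\partial G)},$$ where $d(z,\partial G)$ is the Euclidean distance from $z$ to the boundary of $G$ and $\Gamma_{xy}$ is the collection of all rectifiable curves in $G$ joining $x$ and $y$. (For $G=\mathbb{R}^n\setminus\{0\}$ one has $d(z,\partial G)=|z|$.) The quasihyperbolic ball is $D_G(x,M) = \{z \in G : k_G(x,z) < M\}$ for $x\in G$, $M>0$. A domain $D\subset\mathbb{R}^n$ is starlike with respect to $x \in D$ if for each $y\in D$ the line segment from $x$ to $y$ is contained in $D$. It is strictly starlike with respect to $x \in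 D$ if $D$ is bounded and each ray from $x$ meets $\partial D$ at exactly one point. Strictly convex is meant in the usual sense: the open line segment between any two distinct points of the closure lies in the interior (i.e. the set is convex and its boundary contains no nondegenerate line segment). *)

(* Defs.v *)
From HB Require Import structures.
From mathcomp Require Import all_boot all_order all_algebra.
From mathcomp Require Import all_classical all_reals all_analysis.

Set Implicit Arguments.
Unset Strict Implicit.
Unset Printing Implicit Defensive.

Import Order.TTheory GRing.Theory Num.Theory.
Import numFieldNormedType.Exports.

Local Open Scope classical_set_scope.
Local Open Scope ring_scope.

Section euclidean.
Context {R : realType} {n : nat}.
Implicit Types (x y z u : 'rV[R]_n) (A D G : set 'rV[R]_n).

(* The library norm on 'rV[R]_n is the max norm; it induces the usual topology
   and the usual bounded sets, but lengths and distances need the Euclidean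
   norm. *)
Definition enorm x : R := Num.sqrt (\sum_(i < n) x ord0 i ^+ 2).

Definition boundary A : set 'rV[R]_n := closure A `\` interior A.

(* The infimum of an empty set of reals is 0 in the library, so this is only
   meaningful when the boundary of G is nonempty, as it is for every proper
   subdomain. *)
Definition dist_boundary G z : R := inf [set enorm (z - w) | w in boundary G].

(* The analogue of [total_variation] for curves in Euclidean space. *)
Definition chord_length (a b : R) (g : R -> 'rV[R]_n) (s : seq R) : R :=
  let F := g \o nth b (a :: s) in
  \sum_(0 <= i < size s) enorm (F i.+1 - F i).

Definition curve_length (a b : R) (g : R -> 'rV[R]_n) : \bar R :=
  ereal_sup [set (chord_length a b g s)%:E | s in itv_partition a b].

(* [g] reparametrized by arc length. The chosen parameter t is irrelevant: a
   continuous curve is constant on {t | length of g over [a, t] is s}. *)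
Definition arclength_param (a b : R) (g : R -> 'rV[R]_n) (s : R) : 'rV[R]_n :=
  g (xget a [set t | a <= t <= b /\ curve_length a t g = s%:E]).

Definition line_integral (rho : 'rV[R]_n -> R) (a b : R) (g : R -> 'rV[R]_n) :
    \bar R :=
  (\int[lebesgue_measure]_(s in `[0%R, fine (curve_length a b g)])
     (rho (arclength_param a b g s))%:E)%E.

Definition rectifiable_curve G x y (a b : R) (g : R -> 'rV[R]_n) : Prop :=
  [/\ a <= b, {within `[a, b], continuous g}, g @` `[a, b] `<=` G,
      g a = x /\ g b = y & (curve_length a b g < +oo)%E].

Definition qh_dist G x y : \bar R :=
  ereal_inf [set l | exists a b g, rectifiable_curve G x y a b g /\
    l = line_integral (fun z => (dist_boundary G z)^-1) a b g].

Definition qh_ball G x (M : R) : set 'rV[R]_n :=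
  [set z | G z /\ (qh_dist G x z < M%:E)%E].

Definition strictly_convex A : Prop :=
  forall x y, closure A x -> closure A y -> x <> y ->
  forall t : R, 0 < t < 1 -> interior A ((1 - t) *: x + t *: y).

Definition segment x y : set 'rV[R]_n :=
  [set (1 - t) *: x + t *: y | t in `[0, 1]].

Definition ray x u : set 'rV[R]_n := [set x + t *: u | t in `[0, +oo[].

(* In both notions below D is a domain and x a point of D. *)
Definition starlike D x : Prop := forall y, D y -> segment x y `<=` D.

Definition strictly_starlike D x : Prop :=
  bounded_set D /\
  forall u, u != 0 -> exists! z, (ray x u `&` boundary D) z.

End euclidean.

Definition kappa_equation {R : realType} (p : R) : Prop :=
  let q := Num.sqrt (p ^+ 2 - 1) in cos q + q * sin q = expR (- 1).

(* Main.v *)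
Require Import Defs.
From mathcomp Require Import all_boot all_order all_algebra.
From mathcomp Require Import all_classical all_reals all_analysis.
From mathcomp Require Import ring lra.

(** In the coordinates [ln |z|] and [z / |z|] the weighted length element
    [|dz| / |z|] is that of the product of a line and a sphere. Hence the
    quasihyperbolic distance of the punctured space is [cone_dist], the hypotenuse
    of the difference of the logarithms of the norms and the angle
    ([qh_dist_setC0]). For the lower bound, [cone_dist] satisfies the triangle
    inequality and is infinitesimally at most [|dz| / |z|] ([cone_dist_triangle],
    [cone_dist_local]), so along a curve it grows no faster than the integral
    ([cone_dist_le_line_integral]). The upper bound comes from the logarithmic
    spiral in the plane of the two points ([spiral_integral_le]).

    After a dilation the centre is the point 1, and in the plane of the centre and
    another point the squared distance is [F = l ^ 2 + phi ^ 2], where [l] is the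
    logarithm of the norm and [phi] the angle. A line that avoids the origin is a
    graph over [phi] with [l'' = 1 + l' ^ 2], so along it
    [F'' = 2 * (1 + l' ^ 2) * (1 + l)] ([is_derive_line_sqdist']). Both radii of the
    theorem are governed by the sign change of [1 + l].

    Convexity: the disc [F <= 1] lies in the half plane of abscissas at least
    [1 / e] ([polar_abscissa_ge]), where [l >= -1]; so [F] is quasiconvex on its
    chords ([planar_strictly_convex]). In higher dimension the abscissa of a
    segment is affine and the distance to the axis is convex, which reduces the
    claim to the plane ([cone_dist_strictly_convex]). For a radius [M > 1] the
    tangent line at the boundary point nearest to the origin has [l = - M < -1], and
    it is inside the ball on both sides of that point ([cone_ball_not_convex]).

    Starlikeness: along a line through 1 the derivative of [F] has the sign of
    [star l phi] ([star_line]). On the part of the circle [l ^ 2 + phi ^ 2 = p ^ 2]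
    with obtuse [phi] this function is smallest at [l = -1], because its derivative
    has the factor [1 + l] ([star_circle]), and [star (-1) phi = cos phi + phi * sin phi - e ^ -1], which
    vanishes for [p = kappa] and is negative for [p] between kappa and [pi]. So up to
    the radius kappa [F] increases along rays ([line_sqdist_lt]), including
    through the inflection point [(-1, q)] with [q ^ 2 = kappa ^ 2 - 1]. Beyond kappa
    some ray leaves the ball and enters it again ([not_starlike_cone_ball]), and
    beyond [pi] the ball contains the antipode of its centre but not the origin.

    The decimals of kappa follow from the signs of the errors of Taylor
    polynomials ([exists_tangency]). *)

Set Implicit Arguments.
Unset Strict Implicit.
Unset Printing Implicit Defensive.

Import Order.TTheory GRing.Theory Num.Theory.
Import numFieldNormedType.Exports.

Local Open Scope classical_set_scope.
Local Open Scope ring_scope.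


(** * Mean value inequalities *)

Section mean_value.
Context {R : realType}.
Implicit Types (f df : R -> R) (a b : R).

Lemma is_derive_mvt f df a b : a < b ->
  (forall x, a <= x <= b -> is_derive x 1 f (df x)) ->
  exists2 c, a < c < b & f b - f a = df c * (b - a).
Proof.
move=> ab fd; case: (@MVT _ f df _ _ ab).
- by move=> x /[!in_itv]/= /andP[ax xb]; apply: fd; rewrite !ltW.
- apply: derivable_within_continuous => x /[!in_itv]/= axb.
  by case: (fd _ axb).
- by move=> c /[!in_itv]/= acb ?; exists c.
Qed.

Lemma is_derive_lt f df a b : a < b ->
  (forall x, a <= x <= b -> is_derive x 1 f (df x)) ->
  (forall x, a < x < b -> 0 < df x) -> f a < f b.
Proof.
move=> ab fd df0; have [c acb eqf] := is_derive_mvt ab fd.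
by rewrite -subr_gt0 eqf mulr_gt0 ?df0 ?subr_gt0.
Qed.

Lemma is_derive_le f df a b : a <= b ->
  (forall x, a <= x <= b -> is_derive x 1 f (df x)) ->
  (forall x, a < x < b -> 0 <= df x) -> f a <= f b.
Proof.
rewrite le_eqVlt => /predU1P[->//|ab] fd df0.
have [c acb eqf] := is_derive_mvt ab fd.
by rewrite -subr_ge0 eqf mulr_ge0 ?df0 ?subr_ge0 ?ltW.
Qed.

End mean_value.

(** * Euclidean geometry *)

Section dot.
Context {R : realType} {n : nat}.
Implicit Types x y z u v w : 'rV[R]_n.

Definition dot x y : R := \sum_(i < n) x ord0 i * y ord0 i.

Lemma dotC x y : dot x y = dot y x.
Proof. by apply: eq_bigr => i _; rewrite mulrC. Qed.

Lemma dotDl x y z : dot (x + y) z = dot x z + dot y z.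
Proof. by rewrite -big_split; apply: eq_bigr => i _; rewrite mxE mulrDl. Qed.

Lemma dotZl k x y : dot (k *: x) y = k * dot x y.
Proof. by rewrite /dot mulr_sumr; apply: eq_bigr => i _; rewrite mxE mulrA. Qed.

Lemma dotDr x y z : dot x (y + z) = dot x y + dot x z.
Proof. by rewrite dotC dotDl !(dotC x). Qed.

Lemma dotZr k x y : dot x (k *: y) = k * dot x y.
Proof. by rewrite dotC dotZl dotC. Qed.

Lemma dotNl x y : dot (- x) y = - dot x y.
Proof. by rewrite -scaleN1r dotZl mulN1r. Qed.

Lemma dotNr x y : dot x (- y) = - dot x y.
Proof. by rewrite dotC dotNl dotC. Qed.

Definition dotE := (dotDl, dotDr, dotZl, dotZr, dotNl, dotNr).

Lemma dotxx_ge0 x : 0 <= dot x x.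
Proof. by apply: sumr_ge0 => i _; rewrite -expr2 sqr_ge0. Qed.

Lemma dotxx_eq0 x : dot x x = 0 -> x = 0.
Proof.
move=> /eqP; rewrite psumr_eq0 => [|i _]; last by rewrite -expr2 sqr_ge0.
move=> /allP h; apply/rowP => i; rewrite mxE.
by have /eqP := h i (mem_index_enum i); move/eqP; rewrite mulf_eq0 orbb => /eqP.
Qed.

Lemma sqr_enorm x : enorm x ^+ 2 = dot x x.
Proof.
rewrite sqr_sqrtr; first by apply: eq_bigr => i _; rewrite expr2.
by apply: sumr_ge0 => i _; rewrite sqr_ge0.
Qed.

Lemma enorm_ge0 x : 0 <= enorm x.
Proof. exact: sqrtr_ge0. Qed.

Lemma enorm_eq0 x : enorm x = 0 -> x = 0.
Proof. by move=> x0; apply: dotxx_eq0; rewrite -sqr_enorm x0 expr0n. Qed.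

Lemma enorm_gt0 x : x != 0 -> 0 < enorm x.
Proof.
by move=> x0; rewrite lt_neqAle enorm_ge0 andbT eq_sym; apply: contra x0 =>
  /eqP/enorm_eq0/eqP.
Qed.

Lemma enormZ k x : enorm (k *: x) = `|k| * enorm x.
Proof.
apply/eqP; rewrite -(@eqrXn2 _ 2) ?mulr_ge0 ?enorm_ge0 ?normr_ge0//.
by rewrite exprMn !sqr_enorm !dotE real_normK ?num_real// mulrA -expr2.
Qed.

Lemma enorm0 : enorm (0 : 'rV[R]_n) = 0.
Proof. by rewrite -(scale0r 0) enormZ normr0 mul0r. Qed.

Lemma enormN x : enorm (- x) = enorm x.
Proof. by rewrite -scaleN1r enormZ normrN1 mul1r. Qed.

Lemma enormBC x y : enorm (x - y) = enorm (y - x).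
Proof. by rewrite -enormN opprB. Qed.

Lemma dot_le x y : dot x y <= enorm x * enorm y.
Proof.
have [->|/enorm_gt0 x0] := eqVneq x 0.
  by rewrite -(scale0r 0) dotZl enormZ normr0 !mul0r.
have [->|/enorm_gt0 y0] := eqVneq y 0.
  by rewrite -(scale0r 0) dotZr enormZ normr0 !mul0r mulr0.
have := dotxx_ge0 (enorm y *: x - enorm x *: y).
rewrite !dotE (dotC y x) -!sqr_enorm => h.
have {}h : 0 <= 2 * (enorm x * enorm y) * (enorm x * enorm y - dot x y) by lra.
by rewrite pmulr_rge0 ?subr_ge0// in h; rewrite !mulr_gt0.
Qed.

Lemma dot_norm_le x y : `|dot x y| <= enorm x * enorm y.
Proof. by rewrite ler_norml dot_le andbT lerNl -dotNl -(enormN x) dot_le. Qed.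

Lemma enormD x y : enorm (x + y) <= enorm x + enorm y.
Proof.
rewrite -ler_sqr ?nnegrE ?addr_ge0 ?enorm_ge0//.
rewrite sqrrD !sqr_enorm !dotE (dotC y x); have := dot_le x y; lra.
Qed.

Lemma enorm_lerB x y : `|enorm x - enorm y| <= enorm (x - y).
Proof.
have hx := enormD (x - y) y; rewrite subrK in hx.
have hy := enormD (y - x) x; rewrite subrK enormBC in hy.
by rewrite ler_norml; lra.
Qed.

Lemma ler_coord_enorm x i : `|x ord0 i| <= enorm x.
Proof.
rewrite -ler_sqr ?nnegrE ?enorm_ge0// sqr_enorm real_normK ?num_real//.
rewrite /dot (bigD1 i)//= -expr2 lerDl sumr_ge0// => j _.
by rewrite -expr2 sqr_ge0.
Qed.

Lemma ler_enorm_sum x : enorm x <= \sum_(i < n) `|x ord0 i|.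
Proof.
have s0 (P : pred 'I_n) : 0 <= \sum_(i < n | P i) `|x ord0 i|.
  exact: sumr_ge0.
rewrite -ler_sqr ?nnegrE ?enorm_ge0// sqr_enorm expr2 big_distrl /=.
apply: ler_sum => i _; rewrite (le_trans (ler_norm _))// normrM.
by rewrite ler_wpM2l// (bigD1 i)//= lerDl.
Qed.

End dot.

Section angle.
Context {R : realType} {n : nat}.
Implicit Types x y z u v w : 'rV[R]_n.

Definition angle x y : R := acos (dot x y / (enorm x * enorm y)).

Lemma cosine_itv x y : -1 <= dot x y / (enorm x * enorm y) <= 1.
Proof.
have [->|/enorm_gt0 x0] := eqVneq x 0.
  by rewrite enorm0 mul0r invr0 mulr0; lra.
have [->|/enorm_gt0 y0] := eqVneq y 0.
  by rewrite enorm0 mulr0 invr0 mulr0; lra.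
rewrite -ler_norml normrM normfV (@gtr0_norm _ (_ * _)) ?mulr_gt0//.
by rewrite ler_pdivrMr ?mulr_gt0// mul1r dot_norm_le.
Qed.

Lemma angle_itv x y : 0 <= angle x y <= pi.
Proof. by rewrite acos_ge0 ?acos_lepi ?cosine_itv. Qed.

Lemma angleC x y : angle x y = angle y x.
Proof. by rewrite /angle dotC (mulrC (enorm x)). Qed.

Lemma cos_angle x y : x != 0 -> y != 0 ->
  dot x y = enorm x * enorm y * cos (angle x y).
Proof.
move=> /enorm_gt0 x0 /enorm_gt0 y0.
by rewrite acosK ?in_itv/= ?cosine_itv// mulrC divfK// gt_eqF// mulr_gt0.
Qed.

Lemma angle_unique x y (t : R) : x != 0 -> y != 0 -> 0 <= t <= pi ->
  dot x y = enorm x * enorm y * cos t -> angle x y = t.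
Proof.
move=> x0 y0 t0; rewrite cos_angle// => /mulfI h.
apply: cos_inj; rewrite ?in_itv/= ?angle_itv//; apply: h.
by rewrite mulf_neq0// gt_eqF// enorm_gt0.
Qed.

Lemma anglexx x : x != 0 -> angle x x = 0.
Proof.
move=> x0; apply: angle_unique => //; first by rewrite lexx pi_ge0.
by rewrite cos0 mulr1 -sqr_enorm expr2.
Qed.

(** The components of two unit vectors orthogonal to a third one obey the
    Cauchy-Schwarz inequality; with the cosines of the angles inserted this is
    the addition formula for the cosine. *)
Lemma acos_dot_triangle x y z : dot x x = 1 -> dot y y = 1 -> dot z z = 1 ->
  acos (dot x z) <= acos (dot x y) + acos (dot y z).
Proof.
move=> x1 y1 z1.
have n1 u : dot u u = 1 -> enorm u = 1.
  move=> u1; apply/eqP; rewrite -(@eqrXn2 _ 2) ?enorm_ge0//.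
  by rewrite sqr_enorm u1 expr1n.
have itv u v : dot u u = 1 -> dot v v = 1 -> -1 <= dot u v <= 1.
  by move=> /n1 u1 /n1 v1; have := cosine_itv u v; rewrite u1 v1 mulr1 divr1.
have ixz := itv _ _ x1 z1; have ixy := itv _ _ x1 y1; have iyz := itv _ _ y1 z1.
set p := dot x y in ixy *; set q := dot y z in iyz *; set c := dot x z in ixz *.
have [big|small] := leP pi (acos p + acos q).
  by rewrite (le_trans _ big)// acos_lepi.
have c0 : 0 <= acos c <= pi by rewrite acos_ge0 ?acos_lepi.
have s0 : 0 <= acos p + acos q <= pi by rewrite addr_ge0 ?acos_ge0 ?(ltW small).
rewrite leNgt -ltr_cos ?in_itv//= -leNgt cosD.
rewrite !acosK ?in_itv//= !sin_acos//.
have := dot_le (x - p *: y) (q *: y - z).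
have -> : enorm (x - p *: y) = Num.sqrt (1 - p ^+ 2).
  apply/eqP; rewrite -(@eqrXn2 _ 2) ?enorm_ge0 ?sqrtr_ge0//.
  rewrite sqr_enorm sqr_sqrtr; last by nra.
  by rewrite !dotE (dotC y x) x1 y1 -/p; apply/eqP; ring.
have -> : enorm (q *: y - z) = Num.sqrt (1 - q ^+ 2).
  apply/eqP; rewrite -(@eqrXn2 _ 2) ?enorm_ge0 ?sqrtr_ge0//.
  rewrite sqr_enorm sqr_sqrtr; last by nra.
  by rewrite !dotE (dotC z y) z1 y1 -/q; apply/eqP; ring.
by rewrite !dotE y1 -/p -/q -/c; lra.
Qed.

Lemma angle_triangle x y z : x != 0 -> y != 0 -> z != 0 ->
  angle x z <= angle x y + angle y z.
Proof.
move=> x0 y0 z0.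
have unitE u : u != 0 -> dot ((enorm u)^-1 *: u) ((enorm u)^-1 *: u) = 1.
  by move=> /enorm_gt0 u0; rewrite !dotE -sqr_enorm; field; rewrite gt_eqF.
have angE u v : u != 0 -> v != 0 ->
    angle u v = acos (dot ((enorm u)^-1 *: u) ((enorm v)^-1 *: v)).
  move=> /enorm_gt0 u0 /enorm_gt0 v0; rewrite /angle !dotE; congr acos.
  by field; rewrite !gt_eqF.
by rewrite !angE//; apply: acos_dot_triangle; exact: unitE.
Qed.

(** The law of cosines in half-angle form, which shows separately what the
    radial and the angular displacement contribute to the distance. *)
Lemma sqr_enormB_polar x y : x != 0 -> y != 0 ->
  enorm (x - y) ^+ 2 = (enorm x - enorm y) ^+ 2 +
    4 * (enorm x * enorm y) * sin (angle x y / 2) ^+ 2.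
Proof.
move=> x0 y0; rewrite sqr_enorm !dotE (dotC y x) -!sqr_enorm cos_angle//.
rewrite -[in LHS](divfK (_ : 2 != 0 :> R) (angle x y))//.
rewrite mulr_natr cos_mulr2n cos2sin2; ring.
Qed.

End angle.

Lemma mulr_cos_le_sin {R : realType} (t : R) : 0 <= t <= pi ->
  t * cos t <= sin t.
Proof.
move=> /andP[t0 tpi].
pose f (s : R) := sin s - s * cos s.
have df (s : R) : is_derive s (1 : R) f (s * sin s).
  apply: is_derive_eq; rewrite /GRing.scale/=; ring.
suff : f 0 <= f t by rewrite /f sin0 mul0r subrr subr_ge0.
apply: (is_derive_le t0 (fun s _ => df s)) => s /andP[s0 st].
by rewrite mulr_ge0 ?(ltW s0)// sin_ge0_pi// (ltW s0) (le_trans (ltW st)).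
Qed.

(** * The metric in logarithmic polar coordinates *)

Section cone_dist.
Context {R : realType} {n : nat}.
Implicit Types x y z u v w : 'rV[R]_n.

(** The Euclidean distance in the logarithmic polar coordinates
    [(ln |x|, x / |x|)], with the sphere carrying its angular metric. *)
Definition cone_dist x y : R :=
  Num.sqrt (angle x y ^+ 2 + (ln (enorm x) - ln (enorm y)) ^+ 2).

Lemma cone_dist_ge0 x y : 0 <= cone_dist x y.
Proof. exact: sqrtr_ge0. Qed.

Lemma sqr_cone_dist x y :
  cone_dist x y ^+ 2 = angle x y ^+ 2 + (ln (enorm x) - ln (enorm y)) ^+ 2.
Proof. by rewrite sqr_sqrtr// addr_ge0// sqr_ge0. Qed.

Lemma cone_distC x y : cone_dist x y = cone_dist y x.
Proof.
by rewrite /cone_dist angleC -(opprB (ln (enorm y))) sqrrN.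
Qed.

Lemma cone_distxx x : x != 0 -> cone_dist x x = 0.
Proof.
by move=> x0; rewrite /cone_dist anglexx// subrr expr0n/= addr0 sqrtr0.
Qed.

Lemma ln_le_cone_dist x y : `|ln (enorm x) - ln (enorm y)| <= cone_dist x y.
Proof.
rewrite -ler_sqr ?nnegrE ?cone_dist_ge0// sqr_cone_dist.
by rewrite real_normK ?num_real// lerDr sqr_ge0.
Qed.

Lemma cone_dist_triangle x y z : x != 0 -> y != 0 -> z != 0 ->
  cone_dist x z <= cone_dist x y + cone_dist y z.
Proof.
move=> x0 y0 z0; have cab := angle_triangle x0 y0 z0.
have /andP[a0 _] := angle_itv x z.
have /andP[a1 _] := angle_itv x y; have /andP[a2 _] := angle_itv y z.
rewrite -ler_sqr ?nnegrE ?addr_ge0 ?cone_dist_ge0// sqrrD (sqr_cone_dist x z).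
have := sqr_cone_dist x y; have := sqr_cone_dist y z.
move: cab a0 a1 a2 (cone_dist_ge0 x y) (cone_dist_ge0 y z).
move: (angle x z) (angle x y) (angle y z) (cone_dist x y) (cone_dist y z).
move: (ln (enorm x)) (ln (enorm y)) (ln (enorm z)) => l m k c a b p q.
move=> cab c0 a0 b0 p0 q0 eq_q eq_p.
have c2 : c ^+ 2 <= (a + b) ^+ 2 by rewrite ler_sqr ?nnegrE ?addr_ge0.
suff : a * b + (l - m) * (m - k) <= p * q by lra.
rewrite (le_trans (ler_norm _))// -ler_sqr ?nnegrE ?mulr_ge0// exprMn eq_p eq_q.
rewrite real_normK ?num_real//.
have := sqr_ge0 (a * (m - k) - b * (l - m)); nra.
Qed.

(** The cone metric is infinitesimally [|dz| / |z|]: with [m] a lower bound for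
    both norms, the law of cosines bounds the radial and angular parts of the
    distance by [d / m], up to the ratio between the half angle and its sine. *)
Lemma cone_dist_local u v : u != 0 -> v != 0 -> 2 * enorm (u - v) < enorm u ->
  cone_dist u v <= enorm (u - v) / (enorm u - 2 * enorm (u - v)).
Proof.
move=> u0 v0; have d0 := enorm_ge0 (u - v).
have := sqr_enormB_polar u0 v0; have := enorm_lerB u v.
have r0 := enorm_gt0 u0; have r'0 := enorm_gt0 v0.
have := sqr_cone_dist u v; have k0 := cone_dist_ge0 u v.
have /andP[] := angle_itv u v.
move: (enorm (u - v)) (enorm u) (enorm v) (cone_dist u v) (angle u v)
   d0 r0 r'0 k0 => d r r' k a d0 r0 r'0 k0 a0 api eqk.
rewrite ler_norml => /andP[rr' r'r] eqd dr.
have a2 : 0 <= a / 2 <= pi by lra.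
have s0 : 0 <= sin (a / 2) by rewrite sin_ge0_pi.
have c0 : 0 <= cos (a / 2) by rewrite cos_ge0_pihalf//; have := @pi_ge0 R; lra.
have acs : (a / 2) ^+ 2 * (1 - sin (a / 2) ^+ 2) <= sin (a / 2) ^+ 2.
  rewrite -cos2sin2 -exprMn ler_sqr ?nnegrE ?mulr_ge0 ?mulr_cos_le_sin//; lra.
move: (sin (a / 2)) s0 acs eqd {c0 a2} => s s0 acs eqd.
pose m := r - d; have m0 : 0 < m by rewrite /m; lra.
have lnb : (ln r - ln r') ^+ 2 * m ^+ 2 <= (r - r') ^+ 2.
  have lnub p q : m <= q -> 0 < p -> (ln p - ln q) * m <= Num.max (p - q) 0.
    move=> mq p0; have q0 : 0 < q by rewrite (lt_le_trans m0).
    have [pq|qp] := leP p q.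
      rewrite (le_trans _ (_ : 0 <= _)) ?le_max ?lexx ?orbT//.
      by rewrite mulr_le0_ge0 ?(ltW m0)// subr_le0 ler_ln.
    rewrite (le_trans (ler_wpM2l _ mq)) ?subr_ge0 ?ler_ln ?(ltW qp)//.
    rewrite -ln_div// le_max; apply/orP; left.
    rewrite -ler_pdivlMr// mulrBl divff ?gt_eqF//.
    have := @le_ln1Dx _ (p / q - 1); rewrite (addrC 1) subrK; apply.
    by rewrite -[ltLHS]add0r ltrD2r divr_gt0.
  have := lnub r r' _ r0; have := lnub r' r _ r'0.
  rewrite /m => /(_ ltac:(lra)) h1 /(_ ltac:(lra)) h2.
  rewrite -exprMn -(real_normK (num_real (_ * _))).
  rewrite -(real_normK (num_real (r - r'))) ler_sqr ?nnegrE// ler_norml.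
  have : Num.max (r - r') 0 <= `|r - r'| by rewrite ge_max ler_norm normr_ge0.
  have : Num.max (r' - r) 0 <= `|r - r'|.
    by rewrite distrC ge_max ler_norm normr_ge0.
  by lra.
have sm : s * (2 * m) <= d.
  rewrite -ler_sqr ?nnegrE ?mulr_ge0 ?(ltW m0)// eqd exprMn.
  have : m ^+ 2 <= r * r' by rewrite expr2 ler_pM ?(ltW m0)// /m; lra.
  by have := sqr_ge0 (r - r'); have := sqr_ge0 s; nra.
have dm : d < m by rewrite /m; lra.
have s1 : s <= 1 / 2 by nra.
have k1 : k * ((1 - s) * m) <= d.
  rewrite -ler_sqr ?nnegrE ?mulr_ge0 ?(ltW m0)//; last by lra.
  have : k ^+ 2 * (1 - s ^+ 2) * m ^+ 2 <= d ^+ 2.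
    have : a ^+ 2 * (1 - s ^+ 2) * m ^+ 2 <= 4 * s ^+ 2 * (r * r').
      apply: ler_pM; first by rewrite mulr_ge0 ?sqr_ge0//; nra.
      - exact: sqr_ge0.
      - by move: acs; rewrite expr_div_n; lra.
      - by rewrite expr2 ler_pM ?(ltW m0)// /m; lra.
    have : (ln r - ln r') ^+ 2 * ((1 - s ^+ 2) * m ^+ 2) <= (r - r') ^+ 2.
      rewrite (le_trans _ lnb)// ler_wpM2l ?sqr_ge0// ler_piMl ?sqr_ge0//.
      by have := sqr_ge0 s; lra.
    by rewrite eqk eqd; lra.
  rewrite 2!exprMn mulrA; apply: le_trans.
  by rewrite ler_wpM2r ?sqr_ge0// ler_wpM2l ?sqr_ge0//; nra.
rewrite ler_pdivlMr; last by rewrite /m in dm; lra.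
rewrite (le_trans _ k1)// ler_wpM2l//.
by move: sm; rewrite /m; lra.
Qed.


End cone_dist.


(** * Arc length *)

Section curve_length.
Context {R : realType} {n : nat}.
Implicit Types (a b c t u v : R) (g : R -> 'rV[R]_n) (s : seq R).

Lemma chord_length_nil a b g : chord_length a b g [::] = 0.
Proof. by rewrite /chord_length big_geq. Qed.

Lemma chord_length_cons a b g x s :
  chord_length a b g (x :: s) = enorm (g x - g a) + chord_length x b g s.
Proof. by rewrite /chord_length big_nat_recl. Qed.

Lemma chord_length_rcons a b g s x :
  chord_length a b g (rcons s x) =
  chord_length a b g s + enorm (g x - g (last a s)).
Proof.
elim: s a => [|y s ih] a /=.
  by rewrite chord_length_cons !chord_length_nil add0r addr0.
by rewrite !chord_length_cons ih addrA.
Qed.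

(** Only the entries of [s] matter: the default value of [nth] is never
    reached. *)
Lemma chord_length_default a b c g s : chord_length a b g s = chord_length a c g s.
Proof.
by elim: s a => [|x s ih] a; rewrite ?chord_length_nil// !chord_length_cons ih.
Qed.

Lemma curve_length_ge a b g s : itv_partition a b s ->
  ((chord_length a b g s)%:E <= curve_length a b g)%E.
Proof. by move=> abs; apply: ereal_sup_ubound; exists s. Qed.

Lemma curve_length_le a b g (M : \bar R) :
  (forall s, itv_partition a b s -> ((chord_length a b g s)%:E <= M)%E) ->
  (curve_length a b g <= M)%E.
Proof. by move=> h; apply: ge_ereal_sup => _ [s abs <-]; exact: h. Qed.

Lemma curve_length_chord a b g : a <= b ->
  ((enorm (g b - g a))%:E <= curve_length a b g)%E.
Proof.
rewrite le_eqVlt => /predU1P[<-|ab].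
  rewrite subrr enorm0 -(chord_length_nil a a g).
  by apply: curve_length_ge; split => /=.
apply: le_trans (curve_length_ge g (itv_partition1 ab)).
by rewrite chord_length_cons chord_length_nil addr0.
Qed.

Lemma curve_length_ge0 a b g : a <= b -> (0 <= curve_length a b g)%E.
Proof.
by move=> ab; apply: le_trans (curve_length_chord g ab); rewrite lee_fin enorm_ge0.
Qed.

Lemma curve_lengthxx a g : curve_length a a g = 0%E.
Proof.
apply/eqP; rewrite eq_le curve_length_ge0// andbT; apply: curve_length_le => s.
by move=> /itv_partitionxx ->; rewrite chord_length_nil.
Qed.

Lemma curve_length_cons a b g x : a <= x -> x <= b ->
  ((enorm (g x - g a))%:E + curve_length x b g <= curve_length a b g)%E.
Proof.
rewrite le_eqVlt => /predU1P[<-|ax] xb.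
  by rewrite subrr enorm0 add0e.
rewrite -leeBrDl//; apply: curve_length_le => s xbs; rewrite leeBrDl//.
rewrite -EFinD -chord_length_cons; apply: curve_length_ge.
by case: xbs => p l; split; rewrite //= ax.
Qed.

Lemma curve_length_rcons a b g x : a <= x -> x <= b ->
  (curve_length a x g + (enorm (g b - g x))%:E <= curve_length a b g)%E.
Proof.
move=> ax; rewrite le_eqVlt => /predU1P[<-|xb].
  by rewrite subrr enorm0 adde0.
rewrite -leeBrDr//; apply: curve_length_le => s axs; rewrite leeBrDr//.
case: (axs) => p /eqP l.
have := chord_length_rcons a b g s b; rewrite l => eq_rcons.
rewrite (chord_length_default a x b) -EFinD -eq_rcons.
apply: curve_length_ge; split; last by rewrite last_rcons.
by rewrite rcons_path p l.
Qed.

(** Inserting [c] into a partition of [a, b] does not decrease the length of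
    the inscribed polygon, and splits it into two inscribed polygons. *)
Lemma curve_length_subadd a b c g : a <= c -> c <= b ->
  (curve_length a b g <= curve_length a c g + curve_length c b g)%E.
Proof.
move=> ac cb; apply: curve_length_le => s; elim: s a ac => [|x s ih] a ac abs.
  by rewrite chord_length_nil adde_ge0 ?curve_length_ge0.
rewrite chord_length_cons EFinD.
have ax : a < x by case: abs => /= /andP[].
have xbs := itv_partition_cons abs.
have [cx|xc] := ltP c x.
  have cbs : itv_partition c b (x :: s).
    by case: xbs => p l; split; rewrite //= cx.
  apply: le_trans (leeD (curve_length_chord g ac) (curve_length_ge g cbs)).
  rewrite chord_length_cons EFinD addeA leeD2r// -EFinD lee_fin.
  by rewrite -(subrKA (g c)) (le_trans (enormD _ _))// addrC.
apply: le_trans (leeD2r _ (curve_length_cons g (ltW ax) xc)).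
by rewrite -addeA leeD2l// ih.
Qed.

(** Increments telescope along a partition. Every upper bound for a length
    below is obtained in this way. *)
Lemma curve_length_le_increment a b g (phi : R -> R) :
  (forall u v, a <= u -> u <= v -> v <= b ->
    enorm (g v - g u) <= phi v - phi u) ->
  (curve_length a b g <= (phi b - phi a)%:E)%E.
Proof.
move=> h; apply: curve_length_le => s; rewrite lee_fin.
elim: s a h => [|x s ih] a h abs.
  by rewrite chord_length_nil (itv_partition_nil abs) subrr.
have ax : a < x by case: abs => /= /andP[].
have xb := itv_partition_le (itv_partition_cons abs).
rewrite chord_length_cons.
have h1 := h _ _ (lexx a) (ltW ax) xb.
have h2 : chord_length x b g s <= phi b - phi x.
  apply: ih; last exact: itv_partition_cons abs.
  by move=> u v xu; apply: h; rewrite (le_trans (ltW ax)).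
by lra.
Qed.

End curve_length.

Lemma within_continuous_le {R : realType} (A : set R) (f phi : R -> R) :
  (forall u v, A u -> A v -> `|f u - f v| <= `|phi u - phi v|) ->
  {within A, continuous phi} -> {within A, continuous f}.
Proof.
move=> h /subspace_continuousP cphi; apply/subspace_continuousP => x Ax.
apply/cvgrPdist_lt => e e0.
have /cvgrPdist_lt/(_ e e0) := cphi x Ax.
rewrite !near_withinE; apply: filterS => y + Ay => /(_ Ay).
by apply: le_lt_trans; exact: h.
Qed.

Section arclength.
Context {R : realType} {n : nat} (a b : R) (g : R -> 'rV[R]_n).
Hypothesis ab : a <= b.
Hypothesis lfin : (curve_length a b g < +oo)%E.

Local Notation V t := (fine (curve_length a t g)).

Lemma curve_length_fin t : a <= t -> t <= b -> curve_length a t g \is a fin_num.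
Proof.
move=> at_ tb; rewrite ge0_fin_numE ?curve_length_ge0//.
apply: le_lt_trans lfin; apply: le_trans (curve_length_rcons g at_ tb).
by rewrite leeDl// lee_fin enorm_ge0.
Qed.

Lemma curve_length_fineK t : a <= t -> t <= b -> (V t)%:E = curve_length a t g.
Proof. by move=> ? ?; rewrite fineK// curve_length_fin. Qed.

Lemma arclength_start : V a = 0.
Proof. by rewrite curve_lengthxx. Qed.

Lemma chord_le_arclength t u : a <= t -> t <= u -> u <= b ->
  enorm (g u - g t) <= V u - V t.
Proof.
move=> at_ tu ub; rewrite lerBrDl -lee_fin EFinD !curve_length_fineK//.
- exact: curve_length_rcons.
- exact: le_trans tu.
- exact: le_trans ub.
Qed.

Lemma arclength_le t u : a <= t -> t <= u -> u <= b -> V t <= V u.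
Proof.
by move=> at_ tu ub; rewrite -subr_ge0 (le_trans _ (chord_le_arclength at_ tu ub))// enorm_ge0.
Qed.

Lemma arclength_le_increment (phi : R -> R) t u :
  a <= t -> t <= u -> u <= b ->
  (forall p q, t <= p -> p <= q -> q <= u ->
    enorm (g q - g p) <= phi q - phi p) ->
  V u - V t <= phi u - phi t.
Proof.
move=> at_ tu ub h; rewrite lerBlDl -lee_fin EFinD !curve_length_fineK//.
- apply: le_trans (curve_length_subadd g at_ tu) _.
  by rewrite leeD2l//; exact: curve_length_le_increment.
- exact: le_trans ub.
- exact: le_trans tu.
Qed.

(** A chord is at most the sum of its coordinates, so the increments of the arc
    length are bounded by those of the sum of the total variations of the
    coordinates, and total variation is known to be continuous. *)
Lemma arclength_continuous :
  {within `[a, b], continuous g} -> {within `[a, b], continuous (fun t => V t)}.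
Proof.
move=> cg; move: (ab); rewrite le_eqVlt => /predU1P[aeb|altb].
  rewrite -aeb set_itv1; exact: continuous_subspace1.
pose gi i t := g t ord0 i.
have cgi i : {within `[a, b], continuous (gi i)}.
  apply/subspace_continuousP => t abt.
  apply: (@cvg_comp _ _ _ g (fun M : 'rV[R]_n => M ord0 i) _ (nbhs (g t))).
    move/subspace_continuousP : cg; exact.
  exact: coord_continuous.
have bvi i : bounded_variation a b (gi i).
  exists (V b) => _ [s abs <-].
  rewrite -lee_fin curve_length_fineK//.
  apply: le_trans (curve_length_ge g abs); rewrite lee_fin.
  apply: ler_sum => k _; rewrite /gi /= -[leRHS]/(enorm (_ - _)).
  by apply: le_trans (ler_coord_enorm _ i); rewrite !mxE.
pose phi t := \sum_(i < n) (fine \o total_variation a ^~ (gi i)) t.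
have tvfin i t : a <= t -> t <= b -> total_variation a t (gi i) \is a fin_num.
  move=> at_ tb; apply/bounded_variationP => //.
  exact: bounded_variationl at_ tb (bvi i).
have incr u v : a <= u -> u <= v -> v <= b ->
    enorm (g v - g u) <= phi v - phi u.
  move=> au uv vb; rewrite /phi -sumrB (le_trans (ler_enorm_sum _))//.
  have av := le_trans au uv; have ub := le_trans uv vb.
  apply: ler_sum => i _; rewrite /= lerBrDl -lee_fin EFinD !fineK ?tvfin//.
  rewrite (total_variationD (gi i) au uv) leeD2l//.
  by apply: le_trans (total_variation_ge _ uv); rewrite !mxE.
apply: (@within_continuous_le _ _ _ phi).
  suff h u v : a <= u -> u <= v -> v <= b -> `|V u - V v| <= `|phi u - phi v|.
    move=> u v /=; rewrite !in_itv/= => /andP[au ub] /andP[av vb].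
    have [uv|/ltW vu] := leP u v; first exact: h.
    by rewrite distrC (distrC (phi u)) h.
  move=> au uv vb; rewrite distrC (distrC (phi u)).
  rewrite ger0_norm ?subr_ge0 ?arclength_le// (le_trans _ (ler_norm _))//.
  apply: arclength_le_increment => // p q up pq qv.
  by apply: incr; [exact: le_trans up|by []|exact: le_trans vb].
apply/subspace_continuousP => t abt.
apply: (@cvg_big _ _ +%R) => [|i _]; first exact: add_continuous.
have /subspace_continuousP := total_variation_continuous altb (cgi i) (bvi i).
exact.
Qed.

Local Notation gamma := (arclength_param a b g).

(** The parameter chosen by [arclength_param] does not matter, because the chord
    between two parameters of the same arc length is zero. *)
Lemma arclength_paramK t : a <= t -> t <= b -> gamma (V t) = g t.
Proof.
move=> at_ tb; rewrite /arclength_param.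
set S := [set u | _]; have St : S t by split; rewrite ?at_// curve_length_fineK.
have : S (xget a S) by exact: xgetI St.
move: (xget a S) => u [/andP[au ub]]; rewrite -curve_length_fineK// => -[eqV].
have [ut|/ltW tu] := leP u t.
  have := chord_le_arclength au ut tb; rewrite eqV subrr => h.
  apply/esym/eqP; rewrite -subr_eq0; apply/eqP/enorm_eq0/eqP.
  by rewrite eq_le h enorm_ge0.
have := chord_le_arclength at_ tu ub; rewrite eqV subrr => h.
apply/eqP; rewrite -subr_eq0; apply/eqP/enorm_eq0/eqP.
by rewrite eq_le h enorm_ge0.
Qed.

Lemma arclength_surj t u s : {within `[a, b], continuous g} ->
  a <= t -> t <= u -> u <= b -> V t <= s -> s <= V u ->
  exists2 p, t <= p <= u & V p = s.
Proof.
move=> cg at_ tu ub ts su.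
have cV : {within `[t, u], continuous (fun t => V t)}.
  apply: continuous_subspaceW (arclength_continuous cg).
  by apply: subset_itv; rewrite bnd_simp.
have [|p] := @IVT _ _ _ _ s tu cV.
  by rewrite minEle maxEle arclength_le// ts su.
by rewrite in_itv/= => tpu <-; exists p.
Qed.

Lemma arclength_param_surj s : {within `[a, b], continuous g} ->
  0 <= s -> s <= V b -> exists2 t, a <= t <= b & (V t = s) /\ gamma s = g t.
Proof.
move=> cg s0 sL.
have := arclength_surj cg (lexx a) ab (lexx b) _ sL.
rewrite arclength_start => /(_ s0)[t /andP[at_ tb] <-].
by exists t; rewrite ?at_// arclength_paramK.
Qed.

Lemma arclength_param_lipschitz s s' : {within `[a, b], continuous g} ->
  0 <= s -> s <= s' -> s' <= V b -> enorm (gamma s' - gamma s) <= s' - s.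
Proof.
move=> cg s0 ss' s'L.
have [t' /andP[at' t'b] [eqs' ->]] := arclength_param_surj cg (le_trans s0 ss') s'L.
have [t /andP[at_ tb] [eqs ->]] := arclength_param_surj cg s0 (le_trans ss' s'L).
have [tt'|/ltW t't] := leP t t'; first by rewrite -eqs -eqs'; exact: chord_le_arclength.
have := chord_le_arclength at' t't tb; rewrite enormBC.
by lra.
Qed.

End arclength.


(** * Increments and integrals *)

(** Over a subdivision into [N] equal intervals the quadratic errors add up to
    [O(1 / N)]. This replaces differentiation, which is not available for
    [cone_dist] at the angles 0 and [pi]. *)
Lemma le_increment_quadratic {R : realType} (P Q : R -> R) (L d C : R) :
  0 <= L -> 0 < d -> 0 <= C ->
  (forall s t, 0 <= s -> s <= t -> t <= L -> t - s <= d ->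
    Q t - Q s <= P t - P s + C * (t - s) ^+ 2) ->
  Q L - Q 0 <= P L - P 0.
Proof.
move=> L0 d0 C0 h; apply/ler_addgt0Pr => e e0.
pose N := (Num.truncn (L / d + C * L ^+ 2 / e)).+1.
have q1 : 0 <= L / d by rewrite divr_ge0// ltW.
have q2 : 0 <= C * L ^+ 2 / e by rewrite divr_ge0 ?mulr_ge0 ?sqr_ge0// ltW.
have NE : L / d + C * L ^+ 2 / e < N%:R by exact: truncnS_gt.
have N0 : 0 < N%:R :> R by rewrite ltr0n.
pose p i : R := L / N%:R * i%:R.
have step i : (i <= N)%N ->
    Q (p i) - Q 0 <= P (p i) - P 0 + C * (L / N%:R) ^+ 2 * i%:R.
  elim: i => [_|i ih iN]; first by rewrite /p !mulr0 !subrr add0r.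
  have pS : p i.+1 - p i = L / N%:R by rewrite /p -natr1; ring.
  have LN0 : 0 <= L / N%:R by rewrite divr_ge0// ltW.
  have := h (p i) (p i.+1); rewrite pS => /(_ _ _ _ _)H.
  have {}H : Q (p i.+1) - Q (p i) <= P (p i.+1) - P (p i) + C * (L / N%:R) ^+ 2.
    apply: H.
    - by rewrite mulr_ge0.
    - by rewrite -subr_ge0 pS.
    - rewrite /p -mulrA ler_piMr// mulrC ler_pdivrMr// mul1r.
      by rewrite ler_nat.
    - rewrite ler_pdivrMr// mulrC -ler_pdivrMr//.
      by rewrite (le_trans _ (ltW NE))// lerDl.
  have := ih (ltnW iN); rewrite -natr1 mulrDr mulr1; lra.
have := step N (leqnn _); rewrite /p divfK ?gt_eqF// => /le_trans; apply.
rewrite lerD2l expr_div_n [X in X <= _](_ : _ = C * L ^+ 2 / N%:R); last first.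
  by field; rewrite gt_eqF.
rewrite ler_pdivrMr// (mulrC e) -ler_pdivrMr// (le_trans _ (ltW NE))//.
by rewrite lerDr.
Qed.

Section primitive.
Context {R : realType} (f : R -> R) (L : R).
Hypothesis cf : {within `[0, L], continuous f}.

Let mu := @lebesgue_measure R.
Let P s := (\int[mu]_(x in `[0, s]) f x)%R.

Lemma integrable_primitive : mu.-integrable `[0, L] (EFin \o f).
Proof. exact: continuous_compact_integrable (@segment_compact _ _ _) cf. Qed.

Lemma primitive0 : P 0 = 0.
Proof. by rewrite /P set_itv1 Rintegral_set1. Qed.

Let integrable_sub s t : 0 <= s -> t <= L ->
  mu.-integrable `]s, t] (EFin \o f).
Proof.
move=> s0 tL; apply: integrableS integrable_primitive => //.
by apply: subset_itv; rewrite bnd_simp.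
Qed.

Let primitiveB s t : 0 <= s -> s <= t -> t <= L ->
  P t - P s = (\int[mu]_(x in `]s, t]) f x)%R.
Proof.
move=> s0 st tL; apply: Rintegral_itvB; rewrite ?bnd_simp//.
apply: integrableS integrable_primitive => //.
by apply: subset_itvl; rewrite bnd_simp.
Qed.

Let cst_integrable s t (m : R) : mu.-integrable `]s, t] (EFin \o cst m).
Proof.
apply: integrableS (_ : mu.-integrable `[s, t] (EFin \o cst m)) => //.
  exact: subset_itv_oc_cc.
apply: continuous_compact_integrable; first exact: segment_compact.
by apply: continuous_subspaceT => x; exact: cvg_cst.
Qed.

Let cst_int s t (m : R) : s <= t ->
  (\int[mu]_(x in `]s, t]) m)%R = m * (t - s).
Proof.
move=> st; rewrite Rintegral_cst//.
congr (_ * _); transitivity (fine (t - s)%:E) => //; congr fine.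
rewrite [LHS](lebesgue_measure_itv `]s, t]%R)/= lte_fin.
move: st; rewrite le_eqVlt => /predU1P[->|->//].
by rewrite ltxx subrr.
Qed.

Lemma primitive_increment_ge (m : R) s t : 0 <= s -> s <= t -> t <= L ->
  (forall p, s <= p -> p <= t -> m <= f p) -> m * (t - s) <= P t - P s.
Proof.
move=> s0 st tL h; rewrite primitiveB// -cst_int//.
apply: le_Rintegral => //; [exact: cst_integrable|exact: integrable_sub|].
by move=> p /=; rewrite in_itv/= => /andP[/ltW sp pt]; exact: h.
Qed.

Lemma primitive_increment_le (m : R) s t : 0 <= s -> s <= t -> t <= L ->
  (forall p, s <= p -> p <= t -> f p <= m) -> P t - P s <= m * (t - s).
Proof.
move=> s0 st tL h; rewrite primitiveB// -cst_int//.
apply: le_Rintegral => //; [exact: integrable_sub|exact: cst_integrable|].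
by move=> p /=; rewrite in_itv/= => /andP[/ltW sp pt]; exact: h.
Qed.

End primitive.

(** * Euclidean neighbourhoods *)

Section topology.
Context {R : realType} {n : nat}.
Implicit Types (z v : 'rV[R]_n) (A : set 'rV[R]_n).

Lemma nbhs_enorm z (e : R) : 0 < e -> nbhs z [set v | enorm (v - z) < e].
Proof.
move=> e0; apply/nbhs_ballP; exists (e / n.+1%:R) => /=; first exact: divr_gt0.
move=> v [_ zv] /=; rewrite (le_lt_trans (ler_enorm_sum _))//.
apply: (@le_lt_trans _ _ (\sum_(i < n) e / n.+1%:R)).
  apply: ler_sum => i _; rewrite !mxE distrC.
  exact/ltW/zv.
rewrite sumr_const card_ord -[_ *+ n]mulr_natr -mulrA gtr_pMr// mulrC.
by rewrite ltr_pdivrMr// mul1r ltr_nat.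
Qed.

Lemma nbhs_enormP z A :
  nbhs z A <-> exists2 e : R, 0 < e & forall v, enorm (v - z) < e -> A v.
Proof.
split=> [/nbhs_ballP[e /= e0 zeA]|[e e0 h]].
  exists e => // v vz; apply: zeA; split=> // i j.
  rewrite ord1 /ball/= distrC (le_lt_trans _ vz)//.
  by apply: le_trans (ler_coord_enorm _ j); rewrite !mxE.
by apply: filterS (nbhs_enorm z e0) => v; exact: h.
Qed.

Lemma closure_enorm z A (e : R) : closure A z -> 0 < e ->
  exists2 a, A a & enorm (a - z) < e.
Proof. by move=> cz e0; have [a [Aa]] := cz _ (nbhs_enorm z e0); exists a. Qed.

Hypothesis n0 : (0 < n)%N.

Lemma exists_small (e : R) : 0 < e -> exists2 v : 'rV[R]_n, v != 0 & enorm v < e.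
Proof.
move=> e0; pose u : 'rV[R]_n := delta_mx ord0 (Ordinal n0).
have u0 : u != 0.
  apply/eqP => /rowP/(_ (Ordinal n0)); rewrite !mxE !eqxx => /eqP.
  by rewrite oner_eq0.
exists ((e / 2 / enorm u) *: u).
  by rewrite scaler_eq0 (negbTE u0) orbF gt_eqF// !divr_gt0// enorm_gt0.
rewrite enormZ normrM normfV (ger0_norm (enorm_ge0 u)) divfK ?gt_eqF ?enorm_gt0//.
by rewrite gtr0_norm ?divr_gt0//; lra.
Qed.

Lemma boundary_setC0 : boundary [set~ 0] = [set 0 : 'rV[R]_n].
Proof.
apply/seteqP; split => [z [_]|_ ->].
  apply: contra_notP => /eqP z0; apply/nbhs_enormP.
  exists (enorm z); first exact: enorm_gt0.
  by move=> v + v0; rewrite v0 sub0r enormN ltxx.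
split.
  move=> A /nbhs_enormP[e e0 hA]; have [v v0 ve] := exists_small e0.
  by exists v; split; [exact/eqP|apply: hA; rewrite subr0].
by move=> /nbhs_singleton; apply.
Qed.

Lemma dist_boundary_setC0 z : dist_boundary [set~ 0] z = enorm z.
Proof. by rewrite /dist_boundary boundary_setC0 image_set1 inf1 subr0. Qed.

End topology.


(** * The integral of the inverse norm along a curve *)

Section inverse_norm_integral.
Context {R : realType} {n : nat} (a b : R) (g : R -> 'rV[R]_n).
Hypothesis ab : a <= b.
Hypothesis cg : {within `[a, b], continuous g}.
Hypothesis g0 : forall t, a <= t -> t <= b -> g t != 0.
Hypothesis lfin : (curve_length a b g < +oo)%E.

Local Notation invn := (fun z : 'rV[R]_n => (enorm z)^-1).
Let mu := @lebesgue_measure R.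
Local Notation V t := (fine (curve_length a t g)).
Local Notation gamma := (arclength_param a b g).
Let f s := (enorm (gamma s))^-1.
Let P s := (\int[mu]_(x in `[0%R, s]) f x)%R.

Lemma arclength_param_neq0 s : 0 <= s -> s <= V b -> gamma s != 0.
Proof.
move=> s0 sL.
have [t /andP[at_ tb] [_ ->]] := arclength_param_surj ab lfin cg s0 sL.
exact: g0.
Qed.

Lemma enorm_arclength_continuous :
  {within `[0, V b], continuous (fun s => enorm (gamma s))}.
Proof.
apply: (@within_continuous_le _ _ _ id); last first.
  by apply: continuous_subspaceT => x; exact: cvg_id.
suff h s t : 0 <= s -> s <= t -> t <= V b ->
    `|enorm (gamma s) - enorm (gamma t)| <= `|s - t|.
  move=> s t /=; rewrite !in_itv/= => /andP[s0 sL] /andP[t0 tL].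
  have [st|/ltW ts] := leP s t; first exact: h.
  by rewrite distrC (distrC s) h.
move=> s0 st tL; rewrite (le_trans (enorm_lerB _ _))// enormBC.
rewrite distrC ger0_norm ?subr_ge0//.
exact: arclength_param_lipschitz.
Qed.

Lemma inverse_norm_continuous : {within `[0, V b], continuous f}.
Proof.
have /subspace_continuousP cn := enorm_arclength_continuous.
apply/subspace_continuousP => s /[dup] sL /=; rewrite in_itv/= => /andP[s0 sb].
apply: cvgV; last exact: cn.
by rewrite gt_eqF// enorm_gt0// arclength_param_neq0.
Qed.

Lemma line_integral_primitive :
  line_integral invn a b g = (P (V b))%:E.
Proof.
rewrite /line_integral /P /Rintegral fineK//.
apply: integrable_fin_num => //.
exact: integrable_primitive inverse_norm_continuous.
Qed.

Let V0 : V a = 0. Proof. exact: arclength_start. Qed.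
Let L0 : 0 <= V b. Proof. by rewrite -V0 (arclength_le lfin). Qed.

(** On a piece of arc of length [D] starting at norm [r], the triangle inequality
    and [cone_dist_local] bound the growth of the distance from the starting point
    by [D / (r - 2 * D)], whereas the integral grows by at least [D / (r + D)].
    The norm has a positive minimum [m] on the curve, so that the two differ by
    [O(D ^ 2)]. *)
Lemma cone_dist_le_line_integral :
  ((cone_dist (g a) (g b))%:E <= line_integral invn a b g)%E.
Proof.
rewrite line_integral_primitive lee_fin.
have [c /[!in_itv]/= /andP[c0 cL] cmin] := EVT_min L0 enorm_arclength_continuous.
set m := enorm (gamma c) in cmin.
have m0 : 0 < m by rewrite enorm_gt0// arclength_param_neq0.
have {}cmin s : 0 <= s -> s <= V b -> m <= enorm (gamma s).
  by move=> s0 sL; rewrite cmin// in_itv/= s0.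
pose Q s := cone_dist (g a) (gamma s).
have gVa : gamma 0 = g a by rewrite -V0 arclength_paramK.
have gVb : gamma (V b) = g b by rewrite arclength_paramK.
have -> : cone_dist (g a) (g b) = Q (V b) - Q 0.
  by rewrite /Q gVb gVa cone_distxx ?subr0// g0.
have -> : P (V b) = P (V b) - P 0 by rewrite [P 0]primitive0 subr0.
apply: (@le_increment_quadratic _ P Q (V b) (m / 4) (6 / m ^+ 2)) => //.
- by rewrite divr_gt0.
- by rewrite divr_ge0// sqr_ge0.
move=> s t s0 st tL; set D := t - s => Dm.
have sL := le_trans st tL; have t0 := le_trans s0 st.
have D0 : 0 <= D by rewrite /D subr_ge0.
have gs0 := arclength_param_neq0 s0 sL; have gt0 := arclength_param_neq0 t0 tL.
have ga0 : g a != 0 by exact: g0.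
have mr := cmin _ s0 sL.
have chord u : s <= u -> u <= t -> enorm (gamma u - gamma s) <= D.
  move=> su ut; apply: (@le_trans _ _ (u - s)); last by rewrite lerD2r.
  by apply: arclength_param_lipschitz => //; exact: le_trans tL.
have upper : Q t - Q s <= D / (enorm (gamma s) - 2 * D).
  rewrite /Q lerBlDl (le_trans (cone_dist_triangle ga0 gs0 gt0))// lerD2l.
  have dD := chord _ st (lexx t); rewrite enormBC in dD.
  have d2 : 2 * enorm (gamma s - gamma t) < enorm (gamma s) by lra.
  apply: le_trans (cone_dist_local gs0 gt0 d2) _.
  apply: ler_pM; rewrite ?enorm_ge0// ?invr_ge0; first by lra.
  by rewrite lef_pV2 ?posrE; lra.
have lower : D / (enorm (gamma s) + D) <= P t - P s.
  rewrite mulrC; apply: (primitive_increment_ge inverse_norm_continuous) => //.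
  move=> p sp pt; have p0 := le_trans s0 sp; have pL := le_trans pt tL.
  have := cmin _ p0 pL => mp.
  rewrite /f lef_pV2 ?posrE; [|by lra|by lra].
  have := chord _ sp pt; have := enorm_lerB (gamma p) (gamma s).
  by rewrite ler_norml; lra.
suff : D / (enorm (gamma s) - 2 * D) - D / (enorm (gamma s) + D) <=
    6 / m ^+ 2 * D ^+ 2 by lra.
move: mr D0 Dm m0; move: (enorm _) => r mr D0 Dm m0.
have -> : D / (r - 2 * D) - D / (r + D) =
    3 * D ^+ 2 / ((r - 2 * D) * (r + D)).
  by field; apply/andP; split; rewrite gt_eqF//; lra.
have -> : 6 / m ^+ 2 * D ^+ 2 = 3 * D ^+ 2 / (m / 2 * m).
  by field; rewrite gt_eqF.
rewrite ler_wpM2l ?mulr_ge0 ?sqr_ge0// lef_pV2 ?posrE; last 2 first.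
- by rewrite mulr_gt0//; lra.
- by rewrite mulr_gt0//; lra.
by apply: ler_pM; lra.
Qed.

(** Between the parameters [t] and [u] the length is at most [K * M * (u - t)]
    and the integrand at most [1 / rho], so the integral exceeds [K * (u - t)] by
    [O((u - t) ^ 2)] only. *)
Lemma line_integral_le (K C d : R) : 0 <= K -> 0 <= C -> 0 < d ->
  (forall t u, a <= t -> t <= u -> u <= b -> u - t <= d ->
    exists rho M : R, [/\ 0 < rho, rho <= M,
      (forall p, t <= p -> p <= u -> rho <= enorm (g p)),
      (forall p q, t <= p -> p <= q -> q <= u ->
        enorm (g q - g p) <= K * M * (q - p)) & M / rho <= 1 + C * (u - t)]) ->
  (line_integral invn a b g <= (K * (b - a))%:E)%E.
Proof.
move=> K0 C0 d0 h; rewrite line_integral_primitive lee_fin.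
pose Q t := P (V (a + t)).
have -> : P (V b) = Q (b - a) - Q 0.
  by rewrite /Q addr0 V0 [P 0]primitive0 subr0 (addrC a) subrK.
rewrite -[leRHS]subr0 -[X in _ <= _ - X](mulr0 K).
apply: (@le_increment_quadratic _ (fun t => K * t) Q (b - a) d (K * C)) => //.
- by rewrite subr_ge0.
- exact: mulr_ge0.
move=> s t s0 st tL std.
have as_ : a <= a + s by rewrite lerDl.
have st' : a + s <= a + t by rewrite lerD2l.
have tb : a + t <= b by rewrite -lerBrDl.
have addE : a + t - (a + s) = t - s by ring.
have [|rho [M [rho0 rhoM hrho hM Mrho]]] := h (a + s) (a + t) as_ st' tb.
  by rewrite addE.
rewrite addE in Mrho.
have up : Q t - Q s <= rho^-1 * (V (a + t) - V (a + s)).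
  apply: (primitive_increment_le inverse_norm_continuous).
  - by rewrite -V0 (arclength_le lfin)// (le_trans _ tb).
  - exact: (arclength_le lfin).
  - by rewrite (arclength_le lfin)// (le_trans as_).
  move=> p sp pt.
  have [q /andP[sq qt] <-] := arclength_surj ab lfin cg as_ st' tb sp pt.
  rewrite /f arclength_paramK ?(le_trans as_)// ?(le_trans qt)//.
  rewrite lef_pV2 ?posrE ?hrho//.
  by rewrite enorm_gt0// g0// ?(le_trans as_)// (le_trans qt).
have Vup : V (a + t) - V (a + s) <= K * M * (t - s).
  rewrite -addE mulrBr.
  apply: (arclength_le_increment lfin (phi := fun p => K * M * p)) => //.
  by move=> p q sp pq qt; rewrite -mulrBr hM.
rewrite (le_trans up)// (le_trans (ler_wpM2l _ Vup)) ?invr_ge0 ?(ltW rho0)//.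
rewrite (_ : rho^-1 * _ = K * (t - s) * (M / rho)); last by ring.
rewrite (le_trans (ler_wpM2l _ Mrho)) ?mulr_ge0 ?subr_ge0//.
by rewrite le_eqVlt; apply/orP; left; apply/eqP; ring.
Qed.

End inverse_norm_integral.


(** * Logarithmic spirals and the Martin-Osgood formula *)

Section trigonometric_bounds.
Context {R : realType}.
Implicit Types x : R.

Lemma sin_le_id x : 0 <= x -> sin x <= x.
Proof.
move=> x0.
have df (s : R) : is_derive s (1 : R) (fun s => s - sin s) (1 - cos s).
  exact: is_derive_eq.
have := is_derive_le x0 (fun s _ => df s).
rewrite sin0 subr0 subr_ge0; apply=> s _; by rewrite subr_ge0 cos_le1.
Qed.

Lemma cos_ge_quadratic x : 1 - x ^+ 2 / 2 <= cos x.
Proof.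
suff h (y : R) : 0 <= y -> 1 - y ^+ 2 / 2 <= cos y.
  have [|/ltW x0] := leP 0 x; first exact: h.
  by rewrite -(cosN x) -(sqrrN x) h// oppr_ge0.
move=> y0.
have df (s : R) :
    is_derive s (1 : R) (fun s => cos s - (1 - s ^+ 2 / 2)) (s - sin s).
  by apply: is_derive_eq; rewrite /GRing.scale/=; field.
have := is_derive_le y0 (fun s _ => df s).
rewrite cos0 expr0n/= mul0r !subr0 subrr subr_ge0; apply=> s /andP[s0 _].
by rewrite subr_ge0 sin_le_id// ltW.
Qed.

End trigonometric_bounds.

Section polar.
Context {R : realType} {n : nat}.
Implicit Types (x y e : 'rV[R]_n) (r s t : R).

Definition orthonormal2 e1 e2 := [/\ dot e1 e1 = 1, dot e2 e2 = 1 & dot e1 e2 = 0].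

Definition polar e1 e2 r t : 'rV[R]_n := r *: (cos t *: e1 + sin t *: e2).

Lemma dot_polar e1 e2 r s t u : orthonormal2 e1 e2 ->
  dot (polar e1 e2 r t) (polar e1 e2 s u) = r * s * cos (t - u).
Proof.
move=> [e11 e22 e12]; rewrite !dotE (dotC e2) e11 e22 e12 cosB; ring.
Qed.

Lemma enorm_polar e1 e2 r t : orthonormal2 e1 e2 -> 0 <= r ->
  enorm (polar e1 e2 r t) = r.
Proof.
move=> e12 r0; apply/eqP; rewrite -(@eqrXn2 _ 2) ?enorm_ge0//.
by rewrite sqr_enorm dot_polar// subrr cos0 mulr1 expr2.
Qed.

Lemma polar_neq0 e1 e2 r t : orthonormal2 e1 e2 -> 0 < r ->
  polar e1 e2 r t != 0.
Proof.
move=> e12 r0; apply/eqP => p0; have := enorm_polar t e12 (ltW r0).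
by rewrite p0 enorm0 => r00; rewrite -r00 ltxx in r0.
Qed.

Lemma angle_polar e1 e2 r s t : orthonormal2 e1 e2 -> 0 < r -> 0 < s ->
  0 <= t <= pi -> angle (polar e1 e2 r 0) (polar e1 e2 s t) = t.
Proof.
move=> e12 r0 s0 tpi; apply: angle_unique => //; try exact: polar_neq0.
by rewrite dot_polar// !enorm_polar ?(ltW r0) ?(ltW s0)// sub0r cosN.
Qed.

Lemma polarBE e1 e2 r s t u : orthonormal2 e1 e2 ->
  enorm (polar e1 e2 r t - polar e1 e2 s u) ^+ 2 =
  (r - s) ^+ 2 + 2 * (r * s) * (1 - cos (t - u)).
Proof.
move=> e12; rewrite sqr_enorm !dotDl !dotDr !dotNl !dotNr !dot_polar//.
by rewrite !subrr cos0 -(opprB t u) cosN; ring.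
Qed.

Lemma exists_orthonormal e1 : (2 <= n)%N -> dot e1 e1 = 1 ->
  exists e2, orthonormal2 e1 e2.
Proof.
move=> n2 e11.
have unit w : dot e1 w = 0 -> w != 0 -> orthonormal2 e1 ((enorm w)^-1 *: w).
  move=> e1w /enorm_gt0 w0; split=> //; last by rewrite !dotE e1w mulr0.
  by rewrite !dotE -sqr_enorm; field; rewrite gt_eqF.
pose d (i : 'I_n) : 'rV[R]_n := delta_mx ord0 i.
have dot_d y i : dot y (d i) = y ord0 i.
  rewrite /dot (bigD1 i)//= mxE !eqxx mulr1 big1 ?addr0// => j ji.
  by rewrite mxE (negbTE ji) andbF mulr0.
pose i0 := Ordinal (ltnW n2); pose i1 := Ordinal n2.
have d0 i : d i != 0.
  apply/eqP => /rowP/(_ i); rewrite !mxE !eqxx => /eqP.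
  by rewrite oner_eq0.
have [e10|e10] := eqVneq (e1 ord0 i0) 0.
  by eexists; apply: (unit (d i0)) => //; rewrite dot_d.
pose w := e1 ord0 i1 *: d i0 - e1 ord0 i0 *: d i1.
eexists; apply: (unit w); first by rewrite !dotE !dot_d; ring.
apply/eqP => /rowP/(_ i1); rewrite !mxE !eqxx/= mulr0 mulr1 sub0r => /eqP.
by rewrite oppr_eq0 (negbTE e10).
Qed.

(** The second basis vector is the normalized component of [y] orthogonal to
    [x]; when this component vanishes any unit vector orthogonal to [x] will do,
    and there is one since [n >= 2]. *)
Lemma polar_frame x y : (2 <= n)%N -> x != 0 -> y != 0 ->
  exists e1 e2, [/\ orthonormal2 e1 e2, x = polar e1 e2 (enorm x) 0 &
    y = polar e1 e2 (enorm y) (angle x y)].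
Proof.
move=> n2 x0 y0; have xn := enorm_gt0 x0; have yn := enorm_gt0 y0.
pose e1 := (enorm x)^-1 *: x.
have e11 : dot e1 e1 = 1.
  by rewrite !dotE -sqr_enorm; field; rewrite gt_eqF.
have xE : x = enorm x *: e1 by rewrite scalerA divff ?scale1r// gt_eqF.
have e1y : dot e1 y = enorm y * cos (angle x y).
  by rewrite dotZl cos_angle//; field; rewrite gt_eqF.
clearbody e1; pose w := y - (enorm y * cos (angle x y)) *: e1.
have e1w : dot e1 w = 0 by rewrite !dotE e11 e1y mulr1 subrr.
have wn : enorm w = enorm y * sin (angle x y).
  apply/eqP; rewrite -(@eqrXn2 _ 2) ?enorm_ge0 ?mulr_ge0 ?enorm_ge0 ?sin_ge0_pi ?angle_itv//.
  rewrite sqr_enorm !dotE (dotC y e1) e11 e1y -sqr_enorm exprMn sin2cos2.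
  by apply/eqP; ring.
have polar0 e2 : x = polar e1 e2 (enorm x) 0.
  by rewrite /polar cos0 sin0 scale1r scale0r addr0.
have yE : y = (enorm y * cos (angle x y)) *: e1 + w by rewrite addrC subrK.
clearbody w; have [w0|w0] := eqVneq w 0.
  have [e2 e12] := exists_orthonormal n2 e11.
  exists e1, e2; split=> //; rewrite /polar scalerDr !scalerA -wn w0 enorm0.
  by rewrite scale0r addr0 {1}yE w0 addr0.
exists e1, ((enorm w)^-1 *: w); split=> //.
  split=> //; last by rewrite dotZr e1w mulr0.
  by rewrite !dotE -sqr_enorm; field; rewrite gt_eqF// enorm_gt0.
rewrite /polar scalerDr !scalerA -wn divff ?scale1r//.
by rewrite gt_eqF// enorm_gt0.
Qed.

End polar.

Section spiral.
Context {R : realType} {n : nat} (e1 e2 : 'rV[R]_n) (r l th : R).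
Hypothesis e12 : orthonormal2 e1 e2.
Hypothesis r0 : 0 < r.

Let K := Num.sqrt (th ^+ 2 + l ^+ 2).
Let rad t := r * expR (l * t).

Definition spiral t := polar e1 e2 (r * expR (l * t)) (th * t).

Let rad_gt0 t : 0 < rad t.
Proof. by rewrite mulr_gt0 ?expR_gt0. Qed.

Let K0 : 0 <= K. Proof. exact: sqrtr_ge0. Qed.

Lemma enorm_spiral t : enorm (spiral t) = r * expR (l * t).
Proof. by rewrite enorm_polar ?ltW ?rad_gt0. Qed.

Lemma spiral_neq0 t : spiral t != 0.
Proof. by rewrite polar_neq0 ?rad_gt0. Qed.

Lemma spiral_continuous : continuous spiral.
Proof.
move=> t; have ct (f : R -> R) (c : R) : continuous f ->
    f (c * s) @[s --> t] --> f (c * t).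
  move=> cf; apply: (@continuous_comp _ _ _ (fun s => c * s) f); last exact: cf.
  by apply: cvgZr; exact: cvg_id.
apply: cvgZ.
  by apply: cvgM; [exact: cvg_cst|exact: ct (@continuous_expR R)].
apply: cvgD; apply: cvgZ; try exact: cvg_cst.
  exact: ct (@continuous_cos R).
exact: ct (@continuous_sin R).
Qed.

Lemma spiral_chord p q M : p <= q -> rad p <= M -> rad q <= M ->
  enorm (spiral q - spiral p) <= K * M * (q - p).
Proof.
move=> pq pM qM; have M0 : 0 <= M by rewrite (le_trans _ pM)// ltW.
have D0 : 0 <= q - p by rewrite subr_ge0.
rewrite -ler_sqr ?nnegrE ?enorm_ge0 ?mulr_ge0// polarBE// -/(rad q) -/(rad p).
have incr u v : rad u <= M -> rad u - rad v <= `|l * (v - u)| * M.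
  move=> uM; have -> : rad v = rad u * expR (l * (v - u)).
    by rewrite /rad -mulrA -expRD; congr (_ * expR _); ring.
  have := expR_ge1Dx (l * (v - u)); have := ler_norm (- (l * (v - u))).
  have := normr_ge0 (l * (v - u)); rewrite normrN.
  move: (l * (v - u)) (expR (l * (v - u))) (rad_gt0 u) => d E u0 d0 Nd Ed.
  have : rad u * (1 - E) <= rad u * `|d| by rewrite ler_wpM2l ?(ltW u0)//; lra.
  have : rad u * `|d| <= M * `|d| by rewrite ler_wpM2r.
  by lra.
have drad : (rad q - rad p) ^+ 2 <= l ^+ 2 * M ^+ 2 * (q - p) ^+ 2.
  rewrite -!exprMn -(real_normK (num_real (rad q - _))).
  rewrite -[leRHS](real_normK (num_real _)) ler_sqr ?nnegrE//.
  rewrite normrM (normrM l) (ger0_norm M0) (mulrAC `|l|) -normrM ler_norml.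
  by have := incr _ p qM; have := incr _ q pM; rewrite -(opprB q p) mulrN normrN; lra.
have dang : 2 * (rad q * rad p) * (1 - cos (th * q - th * p)) <=
    th ^+ 2 * M ^+ 2 * (q - p) ^+ 2.
  have c1 := cos_ge_quadratic (th * q - th * p).
  have -> : th ^+ 2 * M ^+ 2 * (q - p) ^+ 2 =
      2 * (M * M) * ((th * q - th * p) ^+ 2 / 2) by field.
  apply: ler_pM.
  - by rewrite !mulr_ge0// ltW.
  - by rewrite subr_ge0 cos_le1.
  - by rewrite ler_wpM2l// ler_pM// ltW.
  - by lra.
rewrite 2!exprMn sqr_sqrtr ?addr_ge0 ?sqr_ge0//; lra.
Qed.

Let rad_near t p d : `|p - t| <= d ->
  rad t * expR (- (`|l| * d)) <= rad p <= rad t * expR (`|l| * d).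
Proof.
move=> ptd; have -> : rad p = rad t * expR (l * (p - t)).
  by rewrite /rad -mulrA -expRD; congr (_ * expR _); ring.
rewrite !ler_pM2l// !ler_expR -ler_norml normrM ler_wpM2l//.
Qed.

Lemma spiral_curve_length_fin : (curve_length 0 1 spiral < +oo)%E.
Proof.
pose phi s := K * (rad 0 * expR (`|l| * 1)) * s.
apply: le_lt_trans (ltry (phi 1 - phi 0)).
apply: curve_length_le_increment => // u v u0 uv v1.
rewrite /phi -mulrBr; apply: spiral_chord => //.
  have u01 : `|u - 0| <= 1 by rewrite subr0 ger0_norm// (le_trans uv).
  by case/andP: (rad_near u01).
have v01 : `|v - 0| <= 1 by rewrite subr0 ger0_norm// (le_trans u0).
by case/andP: (rad_near v01).
Qed.

(** The norm is [exp (l * t)] up to a constant and the speed is [K] times the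
    norm; on an interval of length [d] the norm varies by a factor at most
    [exp (2 * |l| * d)]. *)
Lemma spiral_integral_le :
  (line_integral (fun z : 'rV[R]_n => (enorm z)^-1)%R 0 1 spiral <= K%:E)%E.
Proof.
rewrite -[K]mulr1 -[X in K * X](subr0 1).
pose C := 2 * `|l| * expR (2 * `|l|).
apply: (@line_integral_le _ _ 0 1 spiral _ _ _ _ K C 1) => //.
- by apply: continuous_subspaceT => t; exact: spiral_continuous.
- by move=> t _ _; exact: spiral_neq0.
- exact: spiral_curve_length_fin.
- by rewrite !mulr_ge0// expR_ge0.
move=> t u t0 tu u1 ut1; pose d := u - t.
have d0 : 0 <= d by rewrite subr_ge0.
exists (rad t * expR (- (`|l| * d))), (rad t * expR (`|l| * d)).
have near p : t <= p -> p <= u -> `|p - t| <= d.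
  by move=> tp pu; rewrite ger0_norm ?subr_ge0// lerD2r.
split.
- by rewrite mulr_gt0// expR_gt0.
- by rewrite ler_pM2l// ler_expR; have := mulr_ge0 (normr_ge0 l) d0; lra.
- by move=> p tp pu; rewrite enorm_spiral; case/andP: (rad_near (near _ tp pu)).
- move=> p q tp pq qu; apply: spiral_chord => //.
    by case/andP: (rad_near (near _ tp (le_trans pq qu))).
  by case/andP: (rad_near (near _ (le_trans tp pq) qu)).
have -> : rad t * expR (`|l| * d) / (rad t * expR (- (`|l| * d))) =
    expR (2 * `|l| * d).
  rewrite -mulf_div divff ?gt_eqF// mul1r -expRB; congr expR; ring.
set c := 2 * `|l|; have c0 : 0 <= c by rewrite mulr_ge0.
have cd0 : 0 <= c * d by rewrite mulr_ge0.
have h1 := expR_ge1Dx (- (c * d)).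
have e1_ : expR (c * d) * expR (- (c * d)) = 1 by rewrite -expRD subrr expR0.
have h2 : expR (c * d) <= expR c by rewrite ler_expR ler_piMr.
have h3 := expR_gt0 (c * d).
have h4 : expR (c * d) * (1 - c * d) <= 1 by rewrite -[leRHS]e1_ ler_wpM2l// ltW.
have h5 : expR (c * d) * (c * d) <= expR c * (c * d) by rewrite ler_wpM2r.
by rewrite /C -/c -/d; lra.
Qed.

End spiral.

Section quasihyperbolic.
Context {R : realType} {n : nat}.
Hypothesis n2 : (2 <= n)%N.
Implicit Types x y z : 'rV[R]_n.

(** The Martin-Osgood formula. Along a curve the logarithmic polar distance
    from the starting point grows at most like the length weighted by the inverse
    norm, and along a logarithmic spiral it grows exactly like it. *)
Lemma qh_dist_setC0 x y : x != 0 -> y != 0 ->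
  qh_dist [set~ 0] x y = (cone_dist x y)%:E.
Proof.
move=> x0 y0; have n1 : (0 < n)%N by exact: ltnW.
have weightE : (fun z : 'rV[R]_n => (dist_boundary [set~ 0] z)^-1) =
    (fun z => (enorm z)^-1).
  by apply/funext => z; rewrite dist_boundary_setC0.
rewrite /qh_dist weightE; apply/eqP; rewrite eq_le; apply/andP; split.
  have [e1 [e2 [e12 xE yE]]] := polar_frame n2 x0 y0.
  have xn := enorm_gt0 x0; have yn := enorm_gt0 y0.
  apply: ge_ereal_inf.
  pose g := spiral e1 e2 (enorm x) (ln (enorm y) - ln (enorm x)) (angle x y).
  exists (line_integral (fun z : 'rV[R]_n => (enorm z)^-1) 0 1 g).
    exists 0, 1, g; split=> //; split=> //.
    - by apply: continuous_subspaceT => t; exact: spiral_continuous.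
    - by move=> _ [t _ <-]; apply/eqP/spiral_neq0.
    - rewrite /g /spiral !mulr0 !mulr1 expR0 mulr1; split; first by rewrite -xE.
      rewrite expRB !lnK ?posrE// mulrC divfK ?gt_eqF//.
    - exact: spiral_curve_length_fin.
  apply: le_trans (spiral_integral_le _ _ e12 xn) _.
  by rewrite lee_fin /cone_dist -(opprB (ln (enorm x))) sqrrN.
apply: le_ereal_inf_tmp => _ [a [b [g [[ab cg gG [ga gb] lfin] ->]]]].
rewrite -ga -gb; apply: cone_dist_le_line_integral => // t at_ tb.
by apply/eqP/gG; exists t => //=; rewrite in_itv/= at_.
Qed.

Lemma qh_ballE x M : x != 0 ->
  qh_ball [set~ 0] x M = [set z | z != 0 /\ cone_dist x z < M].
Proof.
move=> x0; apply/seteqP; split => z [z0].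
  by move/eqP in z0; rewrite qh_dist_setC0// lte_fin.
by move=> zM; split; [exact/eqP|rewrite qh_dist_setC0// lte_fin].
Qed.

End quasihyperbolic.


(** * Taylor polynomials with alternating errors *)

Section taylor.
Context {R : realType}.
Implicit Types x : R.

(** This is [x ^ k / k!]; the recursion keeps the numerical evaluations below
    from computing factorials in unary. *)
Fixpoint monomial k x : R :=
  if k is j.+1 then monomial j x * (x / k%:R) else 1.

Lemma monomial0 k : monomial k.+1 0 = 0.
Proof. by rewrite /= mul0r mulr0. Qed.

Lemma monomialE k x : monomial k x = (k`!%:R)^-1 * x ^+ k.
Proof.
elim: k => [|k ih] /=; first by rewrite fact0 invr1 mulr1.
rewrite ih factS natrM exprS invfM; ring.
Qed.

Lemma is_derive_monomial k x :
  is_derive x (1 : R) (monomial k.+1) (monomial k x).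
Proof.
have -> : monomial k.+1 = (fun y => (k.+1`!%:R)^-1 * y ^+ k.+1).
  by apply/funext => y; rewrite monomialE.
have dX : is_derive x (1 : R) (fun y : R => y ^+ k.+1) (k.+1%:R * x ^+ k).
  apply: DeriveDef; first exact: exprn_derivable.
  by rewrite exp_derive /GRing.scale/= mulr1.
have dcX (c : R) :
    is_derive x (1 : R) (fun y => c * y ^+ k.+1) (c * (k.+1%:R * x ^+ k)).
  by apply: is_derive_eq; rewrite /GRing.scale/=; ring.
apply: (is_derive_eq (dcX _)); rewrite monomialE factS natrM.
by field; rewrite nat1r !pnatr_eq0 -lt0n fact_gt0.
Qed.

(** For [j = 0] and [j = 1] these are the Taylor polynomials of cosine and
    sine. *)
Fixpoint alternating_sum j n x : R :=
  if n is m.+1 then alternating_sum j m x + (-1) ^+ m * monomial (j + m.*2) x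
  else 0.

Lemma is_derive_alternating_sum1 n x :
  is_derive x (1 : R) (alternating_sum 1 n) (alternating_sum 0 n x).
Proof.
elim: n => [|n ih] /=; first exact: is_derive_cst.
have := is_derive_monomial n.*2 x => dm.
by apply: is_deriveD.
Qed.

Lemma is_derive_alternating_sum0 n x :
  is_derive x (1 : R) (alternating_sum 0 n.+1) (- alternating_sum 1 n x).
Proof.
elim: n => [|n ih]; first by rewrite /= oppr0; exact: is_derive_cst.
have -> : alternating_sum 0 n.+2 = (fun y => alternating_sum 0 n.+1 y +
    (-1) ^+ n.+1 * monomial (n.*2).+2 y) by [].
have dm := is_derive_monomial n.*2.+1 x.
apply: is_derive_eq; rewrite /GRing.scale/= exprS; ring.
Qed.

Lemma alternating_sum0 n : alternating_sum 0 n.+1 0 = 1.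
Proof.
elim: n => [|n ih]; first by rewrite /= mul1r add0r.
rewrite -[LHS]/(alternating_sum 0 n.+1 0 +
  (-1) ^+ n.+1 * monomial (n.*2).+2 0).
by rewrite ih monomial0 mulr0 addr0.
Qed.

Lemma alternating_sum10 n : alternating_sum 1 n 0 = 0.
Proof. by elim: n => [//|n ih] /=; rewrite ih mul0r !mulr0 addr0. Qed.

(** Successive integration of [cos <= 1]: the errors of the Taylor polynomials
    of sine and cosine have alternating signs. *)
Lemma cos_sin_taylor n x : 0 <= x ->
  0 <= (-1) ^+ n.+1 * (cos x - alternating_sum 0 n.+1 x) /\
  0 <= (-1) ^+ n.+1 * (sin x - alternating_sum 1 n.+1 x).
Proof.
have sin_step m : (forall y, 0 <= y ->
      0 <= (-1) ^+ m * (cos y - alternating_sum 0 m y)) ->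
    forall y, 0 <= y -> 0 <= (-1) ^+ m * (sin y - alternating_sum 1 m y).
  move=> h y y0.
  have df (s : R) : is_derive s (1 : R)
      (fun s => (-1) ^+ m * (sin s - alternating_sum 1 m s))
      ((-1) ^+ m * (cos s - alternating_sum 0 m s)).
    have := is_derive_alternating_sum1 m s => ?.
    by apply: is_derive_eq; rewrite /GRing.scale/=; ring.
  have := is_derive_le y0 (fun s _ => df s).
  rewrite sin0 alternating_sum10 subrr mulr0; apply=> s /andP[/ltW s0 _].
  exact: h.
elim: n x => [|n ih] x x0.
  have c1 y : 0 <= y -> 0 <= (-1) ^+ 1 * (cos y - alternating_sum 0 1 y).
    by move=> _; rewrite /= mulr1 add0r expr1 mulN1r opprB subr_ge0 cos_le1.
  by split; [exact: c1|exact: sin_step].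
have c2 y : 0 <= y -> 0 <= (-1) ^+ n.+2 * (cos y - alternating_sum 0 n.+2 y).
  move=> y0.
  have df (s : R) : is_derive s (1 : R)
      (fun s => (-1) ^+ n.+2 * (cos s - alternating_sum 0 n.+2 s))
      ((-1) ^+ n.+1 * (sin s - alternating_sum 1 n.+1 s)).
    have := is_derive_alternating_sum0 n.+1 s => ?.
    by apply: is_derive_eq; rewrite /GRing.scale/= [in LHS]exprS; ring.
  have := is_derive_le y0 (fun s _ => df s).
  rewrite cos0 alternating_sum0 subrr mulr0; apply=> s /andP[/ltW s0 _].
  by case: (ih s s0).
by split; [exact: c2|exact: sin_step].
Qed.

Fixpoint expN_sum n x : R :=
  if n is m.+1 then expN_sum m x + (-1) ^+ m * monomial m x else 0.

Lemma is_derive_expN_sum n x :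
  is_derive x (1 : R) (expN_sum n.+1) (- expN_sum n x).
Proof.
elim: n => [|n ih]; first by rewrite /= oppr0; exact: is_derive_cst.
have -> : expN_sum n.+2 = (fun y => expN_sum n.+1 y +
    (-1) ^+ n.+1 * monomial n.+1 y) by [].
have dm := is_derive_monomial n x.
apply: is_derive_eq; rewrite /GRing.scale/= exprS; ring.
Qed.

Lemma expRN_taylor n x : 0 <= x ->
  0 <= (-1) ^+ n * (expR (- x) - expN_sum n x).
Proof.
elim: n x => [|n ih] x x0; first by rewrite mul1r subr0 expR_ge0.
have df (s : R) : is_derive s (1 : R)
    (fun s => (-1) ^+ n.+1 * (expR (- s) - expN_sum n.+1 s))
    ((-1) ^+ n * (expR (- s) - expN_sum n s)).
  have := is_derive_expN_sum n s => ?.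
  by apply: is_derive_eq; rewrite /GRing.scale/= [in LHS]exprS; ring.
have := is_derive_le x0 (fun s _ => df s).
have -> : expN_sum n.+1 0 = 1.
  elim: n {ih df} => [|n ih]; first by rewrite /= mulr1 add0r.
  by rewrite [LHS]/= -/(expN_sum n.+1 0) ih mul0r !mulr0 addr0.
rewrite oppr0 expR0 subrr mulr0; apply=> s /andP[/ltW s0 _].
exact: ih.
Qed.

End taylor.


(** * The constant kappa *)

Section numerical_bounds.
Context {R : realType}.

Lemma expRN1_bounds :
  367 / 10 ^+ 3 + 879 / 10 ^+ 6 + 18 / 10 ^+ 8 <= expR (- 1 : R) <=
  367 / 10 ^+ 3 + 879 / 10 ^+ 6 + 5 / 10 ^+ 7.
Proof.
have := @expRN_taylor R 10 1 ler01; have := @expRN_taylor R 11 1 ler01.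
move: (expR _) => e; cbv [expN_sum monomial].
lra.
Qed.

(** With [q = sqrt (p ^ 2 - 1)] this is the left-hand side of the equation that
    defines kappa. *)
Definition tangency (q : R) : R := cos q + q * sin q.

Lemma tangency_below : expR (- 1) < tangency (2 + 650 / 10 ^+ 3 + 605 / 10 ^+ 6).
Proof.
have /andP[_] := expRN1_bounds; rewrite /tangency.
set q : R := 2 + _ + _; have q0 : 0 <= q by rewrite /q; lra.
have [+ _] := cos_sin_taylor 7 q0; have [_ +] := cos_sin_taylor 7 q0.
move: (expR _) (cos q) (sin q) => e c s.
cbv [alternating_sum monomial addn Nat.add double double_rec].
rewrite /q; lra.
Qed.

Lemma tangency_above : tangency (2 + 65 / 10 ^+ 2 + 61 / 10 ^+ 5) < expR (- 1).
Proof.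
have /andP[+ _] := expRN1_bounds; rewrite /tangency.
set q : R := 2 + _ + _; have q0 : 0 <= q by rewrite /q; lra.
have [+ _] := cos_sin_taylor 8 q0; have [_ +] := cos_sin_taylor 8 q0.
move: (expR _) (cos q) (sin q) => e c s.
cbv [alternating_sum monomial addn Nat.add double double_rec].
rewrite /q; lra.
Qed.

Lemma pi_gt3 : 3 < pi :> R.
Proof.
rewrite ltNge; apply/negP => pi3; pose y : R := pi / 2.
have y1 : 1 <= y by exact: pihalf_ge1.
have y2 : y <= 3 / 2 by rewrite /y; lra.
have [+ _] := cos_sin_taylor 3 (le_trans ler01 y1); rewrite cos_pihalf.
cbv [alternating_sum monomial addn Nat.add double double_rec].
have yy : y * y <= 9 / 4 by nra.
move=> h; have : 0 <= y * y by nra.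
move: h; rewrite [X in 0 <= _ * X -> _](_ : _ = - (1 - y * y / 2 +
  (y * y) * (y * y) / 24 - (y * y) * (y * y) * (y * y) / 720)); last by field.
move: (y * y) yy => w w9 h w0.
have : 0 <= w * w * (9 / 4 - w) by rewrite !mulr_ge0//; lra.
have := sqr_ge0 (w - 9 / 4); rewrite expr2.
by move: h; lra.
Qed.

Lemma pi_lt4 : pi < 4 :> R.
Proof. by have := @pihalf_lt2 R; lra. Qed.

Lemma cos_lt0_pihalf (x : R) : pi / 2 < x -> x <= pi -> cos x < 0.
Proof.
move=> x2 xpi; rewrite -cos_pihalf ltr_cos// in_itv/=; have := @pi_gt0 R; lra.
Qed.

Lemma cos_le0_pihalf (x : R) : pi / 2 <= x -> x <= pi -> cos x <= 0.
Proof.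
rewrite le_eqVlt => /predU1P[<-|x2] xpi; first by rewrite cos_pihalf.
exact/ltW/cos_lt0_pihalf.
Qed.

Lemma is_derive_tangency (x : R) : is_derive x (1 : R) tangency (x * cos x).
Proof. by apply: is_derive_eq; rewrite /GRing.scale/=; ring. Qed.

Lemma tangency_ge1 (x : R) : 0 <= x -> x <= pi / 2 -> 1 <= tangency x.
Proof.
move=> x0 x2; have := is_derive_le x0 (fun s _ => is_derive_tangency s).
rewrite {1}/tangency cos0 mul0r addr0; apply=> s /andP[s0 sx].
rewrite mulr_ge0 ?(ltW s0)// cos_ge0_pihalf//; lra.
Qed.

Lemma tangency_decreasing (x y : R) : pi / 2 <= x -> x < y -> y <= pi ->
  tangency y < tangency x.
Proof.
move=> x2 xy ypi; rewrite -subr_gt0.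
have [c /andP[xc cy] cE] := is_derive_mvt xy (fun s _ => is_derive_tangency s).
rewrite -opprB cE oppr_gt0 pmulr_llt0 ?subr_gt0// pmulr_rlt0.
  by apply: cos_lt0_pihalf; lra.
by have := @pi_gt0 R; lra.
Qed.

(** The bounds are decimals on either side of the root, close enough for the
    asserted precision of kappa and far enough for the Taylor polynomials above to
    decide the sign. *)
Lemma exists_tangency : exists q : R,
  [/\ 2 + 650 / 10 ^+ 3 + 605 / 10 ^+ 6 <= q,
      q <= 2 + 65 / 10 ^+ 2 + 61 / 10 ^+ 5 & tangency q = expR (- 1)].
Proof.
set a : R := 2 + _ + _; set b : R := 2 + _ + _.
have ab : a <= b by rewrite /a /b; lra.
have ct : {within `[a, b], continuous tangency}.
  by apply: derivable_within_continuous => x _; case: (is_derive_tangency x).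
have [|q /[!in_itv]/= /andP[aq qb] qE] := IVT (v := expR (- 1)) ab ct.
  have ta := tangency_below; have tb := tangency_above.
  rewrite -/a in ta; rewrite -/b in tb.
  by rewrite ge_min le_max (ltW ta) (ltW tb) orbT.
by exists q.
Qed.

End numerical_bounds.

(** * The sign of the radial derivative *)

Section star_inequality.
Context {R : realType}.

(** [star l phi] is the derivative along [z - 1], up to a positive factor, of
    [|log z| ^ 2 / 2] at the point [z] with logarithmic polar coordinates
    [(l, phi)]: it tells whether the rays from 1 leave the sublevel sets. *)
Definition star (l phi : R) : R := l * expR l - l * cos phi + phi * sin phi.

Lemma mulr_expRN_le (m : R) : m * expR (- m) <= expR (- 1).
Proof.
have := expR_ge1Dx (m - 1); rewrite addrC subrK => h.
have -> : expR (- 1) = expR (m - 1) * expR (- m) :> R.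
  by rewrite -expRD; congr expR; ring.
by rewrite ler_wpM2r// expR_ge0.
Qed.

Lemma mulr_expRN_lt (m : R) : m != 1 -> m * expR (- m) < expR (- 1).
Proof.
rewrite -subr_eq0 => /expR_gt1Dx; rewrite addrC subrK => h.
have -> : expR (- 1) = expR (m - 1) * expR (- m) :> R.
  by rewrite -expRD; congr expR; ring.
by rewrite ltr_pM2r// expR_gt0.
Qed.

Let arc (p s : R) : R := Num.sqrt (p - s ^+ 2).

(** On a circle [l ^ 2 + phi ^ 2 = p] the derivative of [star] with respect to
    [- l] has the factor [1 + l]; the other factor is negative for obtuse [phi]. *)
Lemma is_derive_star_circle (p s : R) : s ^+ 2 < p ->
  is_derive s (1 : R) (fun s => star (- s) (arc p s))
   ((1 - s) * (cos (arc p s) - expR (- s) - s * sin (arc p s) / arc p s)).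
Proof.
move=> sp; have ps : 0 < p - s ^+ 2 by rewrite subr_gt0.
have a0 : 0 < arc p s by rewrite sqrtr_gt0.
have darc : is_derive s (1 : R) (arc p) (- s / arc p s).
  have dsqrt := is_derive1_sqrt ps.
  have din : is_derive s (1 : R) (fun s => p - s ^+ 2) (- (2 * s)).
    by apply: is_derive_eq; rewrite /GRing.scale/=; ring.
  suff : is_derive s (1 : R) (Num.sqrt \o (fun s => p - s ^+ 2)) (- s / arc p s).
    by [].
  apply: (is_derive_eq (@is_derive1_comp _ _ (fun s => p - s ^+ 2) _ _ _ dsqrt din)).
  by rewrite /GRing.scale/= -/(arc p s); field; rewrite gt_eqF.
have dcos : is_derive s (1 : R) (fun s => cos (arc p s)) (- sin (arc p s) * (- s / arc p s)).
  exact: is_derive1_comp.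
have dsin : is_derive s (1 : R) (fun s => sin (arc p s)) (cos (arc p s) * (- s / arc p s)).
  exact: is_derive1_comp.
rewrite /star; apply: is_derive_eq; rewrite /GRing.scale/=.
by field; rewrite gt_eqF.
Qed.

Lemma star_circle (p m : R) : 1 < p -> 0 <= m -> m != 1 -> m ^+ 2 < p ->
  pi / 2 <= arc p (Num.max 1 m) -> arc p (Num.min 1 m) <= pi ->
  star (- 1) (arc p 1) < star (- m) (arc p m).
Proof.
move=> p1 m0 m1 mp lo hi.
have arc_le u v : 0 <= u -> u <= v -> arc p v <= arc p u.
  move=> u0 uv; rewrite ler_wsqrtr// lerB// ler_sqr ?nnegrE//.
  exact: le_trans uv.
have bracket s : Num.min 1 m <= s -> s <= Num.max 1 m ->
    cos (arc p s) - expR (- s) - s * sin (arc p s) / arc p s < 0.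
  move=> ms sM; have s0 : 0 <= s by rewrite (le_trans _ ms)// le_min ler01.
  have lo' := le_trans lo (arc_le _ _ s0 sM).
  have hi' : arc p s <= pi.
    by rewrite (le_trans _ hi)// arc_le// le_min ler01.
  have a0 : 0 < arc p s by rewrite (lt_le_trans _ lo')// divr_gt0// pi_gt0.
  have c0 := cos_le0_pihalf lo' hi'; have e0 := expR_gt0 (- s).
  have t0 : 0 <= s * sin (arc p s) / arc p s.
    by rewrite divr_ge0 ?mulr_ge0 ?sin_ge0_pi ?(ltW a0).
  by lra.
have sp s : 0 <= s -> s <= Num.max 1 m -> s ^+ 2 < p.
  move=> s0 sM; apply: (@le_lt_trans _ _ (Num.max 1 m ^+ 2)).
    by rewrite ler_sqr ?nnegrE// le_max ler01.
  by case: (leP 1 m) => _; rewrite ?expr1n.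
have [lt1m|ltm1] : 1 < m \/ m < 1 by case: ltgtP m1; auto.
- rewrite (max_r (ltW lt1m)) (min_l (ltW lt1m)) in bracket sp.
  apply: (is_derive_lt lt1m (f := fun s => star (- s) (arc p s))
    (df := fun s => (1 - s) * (cos (arc p s) - expR (- s) -
       s * sin (arc p s) / arc p s))) => [s /andP[s1 sm]|s /andP[s1 sm]].
    by apply: is_derive_star_circle; rewrite sp// (le_trans ler01).
  by rewrite nmulr_lgt0 ?bracket ?(ltW s1) ?(ltW sm)// subr_lt0.
- rewrite (max_l (ltW ltm1)) (min_r (ltW ltm1)) in bracket sp.
  rewrite -ltrN2.
  apply: (is_derive_lt ltm1 (f := fun s => - star (- s) (arc p s))
    (df := fun s => - ((1 - s) * (cos (arc p s) - expR (- s) -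
       s * sin (arc p s) / arc p s)))) => [s /andP[ms s1]|s /andP[ms s1]].
    have := is_derive_star_circle (sp s (le_trans m0 ms) s1) => ?.
    exact: is_deriveN.
  by rewrite oppr_gt0 pmulr_rlt0 ?bracket ?(ltW ms) ?(ltW s1)// subr_gt0.
Qed.

Variable q : R.
Hypothesis q_ge : 5 / 2 <= q.
Hypothesis q_le : q <= 27 / 10.
Hypothesis qE : tangency q = expR (- 1).

Let q_lepi : q <= pi. Proof. by have := q_le; have := @pi_gt3 R; lra. Qed.

Lemma tangency_ge (x : R) : 0 <= x -> x <= q -> expR (- 1) <= tangency x.
Proof.
move=> x0 xq; have [x2|x2] := leP x (pi / 2).
  by rewrite (le_trans _ (tangency_ge1 x0 x2))// expR_le1 oppr_le0 ler01.
move: xq; rewrite le_eqVlt => /predU1P[->|xq]; first by rewrite qE.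
by rewrite -qE ltW// tangency_decreasing ?(ltW x2).
Qed.

Lemma tangency_gt (x : R) : 0 <= x -> x < q -> expR (- 1) < tangency x.
Proof.
move=> x0 xq; have [x2|x2] := leP x (pi / 2).
  by rewrite (lt_le_trans _ (tangency_ge1 x0 x2))// expR_lt1 oppr_lt0 ltr01.
by rewrite -qE tangency_decreasing ?(ltW x2).
Qed.

Lemma tangency_lt (x : R) : q < x -> x <= pi -> tangency x < expR (- 1).
Proof.
move=> qx xpi; rewrite -qE tangency_decreasing//.
by have := @pi_lt4 R; have := q_ge; lra.
Qed.

(** At acute angles [tangency >= 1] leaves room enough. On the obtuse part of each
    circle [star] is smallest at [l = -1], where it equals [tangency phi - e ^ -1];
    this is positive for [phi < q]. *)
Lemma star_gt0 (l phi : R) : 0 <= phi -> phi < pi ->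
  0 < l ^+ 2 + phi ^+ 2 -> l ^+ 2 + phi ^+ 2 <= 1 + q ^+ 2 ->
  l != - 1 \/ phi != q -> 0 < star l phi.
Proof.
move=> phi0 phipi n0 nq nexc.
have s0 : 0 <= sin phi by rewrite sin_ge0_pi// phi0 ltW.
have pi3 := @pi_gt3 R; have pi4 := @pi_lt4 R.
have q5 := q_ge; have q3 := q_le.
have q2 : (5 / 2) ^+ 2 <= q ^+ 2 by rewrite ler_sqr ?nnegrE//; lra.
have [l0|l0] := leP 0 l.
  have := expR_ge1Dx l; have := cos_le1 phi => c1 e1.
  have h : l * l <= l * (expR l - cos phi) by rewrite ler_wpM2l//; lra.
  move: phi0; rewrite le_eqVlt => /predU1P[phi0|phi0].
    by move: n0 h; rewrite -phi0 expr0n addr0 /star mul0r; lra.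
  have : 0 < phi * sin phi by rewrite mulr_gt0// sin_gt0_pi// phi0.
  by have := sqr_ge0 l; rewrite /star; lra.
pose m := - l; have m0 : 0 < m by rewrite oppr_gt0.
have starE : star l phi = m * cos phi + phi * sin phi - m * expR (- m).
  by rewrite /star /m opprK; ring.
have m2 : l ^+ 2 = m ^+ 2 by rewrite /m sqrrN.
rewrite m2 in nq n0; have mE := mulr_expRN_le m.
have [phi2|phi2] := leP phi (pi / 2).
  have c0 : 0 <= cos phi by rewrite cos_ge0_pihalf//; lra.
  have := tangency_ge1 phi0 phi2; rewrite /tangency starE => t1.
  have [m1|m1] := leP 1 m.
    have : cos phi <= m * cos phi by rewrite ler_peMl.
    have : expR (- 1) < 1 :> R by rewrite expR_lt1 oppr_lt0 ltr01.
    by lra.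
  have : m * (phi * sin phi) <= phi * sin phi by rewrite ler_piMl ?mulr_ge0 ?(ltW m1).
  have : m * expR (- m) < m by rewrite gtr_pMr// expR_lt1 oppr_lt0.
  have : m * 1 <= m * (cos phi + phi * sin phi) by rewrite ler_wpM2l// ltW.
  by lra.
have c0 := cos_lt0_pihalf phi2 (ltW phipi).
have [/andP[m1 phiq]|far] := boolP ((m <= 1) && (phi <= q)).
  have h1 : cos phi <= m * cos phi by have : 0 <= (1 - m) * - cos phi; [by rewrite mulr_ge0 ?subr_ge0 ?oppr_ge0 ?(ltW c0)|lra].
  rewrite starE; case: nexc => [lN1|phiNq].
    have m1' : m != 1 by apply: contra lN1 => /eqP <-; rewrite /m opprK.
    have := tangency_ge phi0 phiq; have := mulr_expRN_lt m1'.
    by rewrite /tangency; lra.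
  have := tangency_gt phi0; rewrite lt_neqAle phiNq phiq => /(_ isT).
  by rewrite /tangency; lra.
pose p := m ^+ 2 + phi ^+ 2.
have arcm : arc p m = phi by rewrite /arc /p (addrC (m ^+ 2)) addrK sqrtr_sqr ger0_norm.
have pq : Num.sqrt (p - 1) <= q.
  rewrite -(ger0_norm (_ : 0 <= q)) -?sqrtr_sqr ?ler_wsqrtr//; last by lra.
  by rewrite /p; lra.
have phisq : (pi / 2) ^+ 2 < phi ^+ 2.
  by rewrite ltr_sqr ?nnegrE// divr_ge0// pi_ge0.
have far' : (1 < m) \/ (m < 1 /\ (pi / 2) ^+ 2 <= p - 1).
  move: far; rewrite negb_and -!ltNge => /orP[|qphi]; first by left.
  have q2phi : q ^+ 2 < phi ^+ 2 by rewrite ltr_sqr ?nnegrE//; lra.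
  have m1 : m ^+ 2 < 1 by lra.
  right; split; first by rewrite -(@ltr_pXn2r _ 2) ?nnegrE ?expr1n// ltW.
  apply: (@le_trans _ _ (2 ^+ 2)); first by rewrite ler_sqr ?nnegrE//; lra.
  by have := sqr_ge0 m; rewrite /p; lra.
have pilt : (pi / 2) ^+ 2 <= p - 1.
  case: far' => [m1|[]//]; rewrite ltW// (lt_trans phisq)// /p ltrBrDl.
  by rewrite ltrD2r expr_gt1// ltW.
have arc1 : arc p 1 = Num.sqrt (p - 1) by rewrite /arc expr1n.
have sqrt_lo : pi / 2 <= Num.sqrt (p - 1).
  rewrite -[leLHS]ger0_norm ?divr_ge0 ?pi_ge0//.
  by rewrite -sqrtr_sqr ler_wsqrtr.
have base : 0 <= star (- 1) (Num.sqrt (p - 1)).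
  have := tangency_ge (sqrtr_ge0 _) pq; rewrite /star /tangency; lra.
have starm : star l phi = star (- m) (arc p m) by rewrite arcm /m opprK.
apply: (le_lt_trans base); rewrite starm -arc1.
apply: star_circle.
- by have := sqr_ge0 (pi / 2 : R); case: far' => [m1|[m1]]; nra.
- exact: ltW.
- by case: far' => [/gt_eqF->|[/lt_eqF->]].
- by rewrite /p ltrDl exprn_gt0//; lra.
- by case: (leP 1 m) => _; rewrite ?arc1// arcm ltW.
- by case: (leP 1 m) => _; rewrite ?arc1 ?arcm ?(ltW phipi)// (le_trans pq)//; lra.
Qed.

End star_inequality.


(** * Lines in logarithmic polar coordinates *)

Section local_monotony.
Context {R : realType}.

Lemma is_derive_gt0_near (f : R -> R) (x d : R) : is_derive x (1 : R) f d -> 0 < d ->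
  (\forall y \near x^'-, f y < f x) /\ (\forall y \near x^'+, f x < f y).
Proof.
move=> /is_derive1_caratheodory[h [fE hC hx]] d0.
have hpos : \forall y \near x, 0 < h y.
  by apply: (cvgr_gt (h x)) hC _ _; rewrite hx.
split; near=> y.
- rewrite -subr_lt0 fE pmulr_rlt0 ?subr_lt0//.
  by near: y; rewrite near_withinE; apply: filterS hpos => ? ? _.
- rewrite -subr_gt0 fE mulr_gt0 ?subr_gt0//.
  by near: y; rewrite near_withinE; apply: filterS hpos => ? ? _.
Unshelve. all: by end_near. Qed.

End local_monotony.

Section line.
Context {R : realType} (A B : R).
Implicit Types a b c phi : R.

(** In polar coordinates the line [A * u + B * v = 1] is the graph of
    [1 / line_recip]. *)
Definition line_recip phi : R := A * cos phi + B * sin phi.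

Definition line_recip' phi : R := B * cos phi - A * sin phi.

(** The squared distance to 1 along the line, in logarithmic polar
    coordinates. *)
Definition line_sqdist phi : R := ln (line_recip phi) ^+ 2 + phi ^+ 2.

Definition line_sqdist' phi : R :=
  2 * (phi + ln (line_recip phi) * line_recip' phi / line_recip phi).

Lemma is_derive_line_recip phi :
  is_derive phi (1 : R) line_recip (line_recip' phi).
Proof. by apply: is_derive_eq; rewrite /GRing.scale/= /line_recip'; ring. Qed.

Lemma is_derive_line_recip' phi :
  is_derive phi (1 : R) line_recip' (- line_recip phi).
Proof. by apply: is_derive_eq; rewrite /GRing.scale/= /line_recip; ring. Qed.

Let is_derive_ln_line phi : 0 < line_recip phi ->
  is_derive phi (1 : R) (fun x => ln (line_recip x)) (line_recip' phi / line_recip phi).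
Proof.
move=> h0; have dh := is_derive_line_recip phi.
have dln := is_derive1_ln h0.
apply: (is_derive_eq (@is_derive1_comp _ _ line_recip _ _ _ dln dh)).
by rewrite mulrC.
Qed.

Lemma is_derive_line_sqdist phi : 0 < line_recip phi ->
  is_derive phi (1 : R) line_sqdist (line_sqdist' phi).
Proof.
move=> h0; have dl := is_derive_ln_line h0.
rewrite /line_sqdist; apply: is_derive_eq.
by rewrite /GRing.scale/= /line_sqdist'; ring.
Qed.

(** A line is [l'' = 1 + l'^2] in logarithmic polar coordinates, so the second
    derivative of [l ^ 2 + phi ^ 2] along it is [2 * (1 + l'^2) * (1 + l)]. *)
Lemma is_derive_line_sqdist' phi : 0 < line_recip phi ->
  is_derive phi (1 : R) line_sqdist'
    (2 * (1 + (line_recip' phi / line_recip phi) ^+ 2) *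
     (1 - ln (line_recip phi))).
Proof.
move=> h0; have dl := is_derive_ln_line h0.
have dh := is_derive_line_recip phi; have dh' := is_derive_line_recip' phi.
have hN0 : line_recip phi != 0 by rewrite gt_eqF.
have dinv := is_deriveV hN0 dh.
rewrite /line_sqdist'; apply: is_derive_eq.
by rewrite /GRing.scale/=; field.
Qed.

Lemma line_recip_interpolation a b phi :
  sin (b - a) * line_recip phi =
  sin (b - phi) * line_recip a + sin (phi - a) * line_recip b.
Proof.
by rewrite /line_recip !sinB; ring.
Qed.

Lemma line_recip_gt0 a b phi : b - a < pi -> a <= phi -> phi <= b ->
  0 < line_recip a -> 0 < line_recip b -> 0 < line_recip phi.
Proof.
move=> bapi aphi phib ha hb.
have [eab|nab] := eqVneq a b; first by have -> : phi = a by lra.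
have ab : a < b by rewrite lt_neqAle nab (le_trans aphi).
have sab : 0 < sin (b - a) by rewrite sin_gt0_pi// subr_gt0 ab.
have s1 : 0 <= sin (b - phi) by rewrite sin_ge0_pi//; lra.
have s2 : 0 <= sin (phi - a) by rewrite sin_ge0_pi//; lra.
rewrite -(pmulr_rgt0 _ sab) line_recip_interpolation.
have [-> |phia] := eqVneq phi a; first by rewrite subrr sin0 mul0r addr0 mulr_gt0.
rewrite ltr_wpDl ?mulr_ge0 ?(ltW ha)// mulr_gt0// sin_gt0_pi//.
by rewrite subr_gt0 lt_neqAle eq_sym phia aphi/=; lra.
Qed.

Lemma line_recip_le0 a b phi : b - a < pi -> a < b -> a <= phi -> phi <= b ->
  line_recip a <= 0 -> line_recip b <= 0 -> line_recip phi <= 0.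
Proof.
move=> bapi ab aphi phib ha hb.
have sab : 0 < sin (b - a) by rewrite sin_gt0_pi// subr_gt0 ab.
have s1 : 0 <= sin (b - phi) by rewrite sin_ge0_pi//; lra.
have s2 : 0 <= sin (phi - a) by rewrite sin_ge0_pi//; lra.
rewrite -(pmulr_rle0 _ sab) line_recip_interpolation.
by rewrite -(addr0 0) lerD// mulr_ge0_le0.
Qed.

Let one_sub_ln_gt0 phi : 0 < line_recip phi -> line_recip phi < expR 1 ->
  0 < 1 - ln (line_recip phi).
Proof. by move=> h0 he; rewrite subr_gt0 -(expRK 1) ltr_ln ?posrE ?expR_gt0. Qed.

Lemma line_sqdist'_lt a b : a < b ->
  (forall phi, a <= phi -> phi <= b -> 0 < line_recip phi) ->
  (forall phi, a < phi -> phi < b -> line_recip phi < expR 1) ->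
  line_sqdist' a < line_sqdist' b.
Proof.
move=> ab h0 he; apply: (is_derive_lt ab) => [phi /andP[ap pb]|phi /andP[ap pb]].
  by apply: is_derive_line_sqdist'; exact: h0.
rewrite mulr_gt0//; last by rewrite one_sub_ln_gt0 ?he ?h0 ?ltW.
by rewrite mulr_gt0// ltr_pwDl// sqr_ge0.
Qed.

(** The derivative increases where the line is outside the disc of radius
    [1 / e], so it cannot be nonnegative before [c] and nonpositive after [c]. *)
Lemma line_sqdist_quasiconvex a c b : a < c -> c < b ->
  (forall phi, a <= phi -> phi <= b -> 0 < line_recip phi) ->
  (forall phi, a < phi -> phi < b -> line_recip phi < expR 1) ->
  line_sqdist c < Num.max (line_sqdist a) (line_sqdist b).
Proof.
move=> ac cb h0 he; rewrite ltNge ge_max; apply/negP => /andP[Fa Fb].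
have [x1 /andP[ax1 x1c] E1] := is_derive_mvt ac (fun phi hphi =>
  is_derive_line_sqdist (h0 phi (andP hphi).1 (le_trans (andP hphi).2 (ltW cb)))).
have [x2 /andP[cx2 x2b] E2] := is_derive_mvt cb (fun phi hphi =>
  is_derive_line_sqdist (h0 phi (le_trans (ltW ac) (andP hphi).1) (andP hphi).2)).
have d1 : 0 <= line_sqdist' x1.
  by move: Fa; rewrite -subr_ge0 E1 pmulr_lge0 ?subr_gt0.
have d2 : line_sqdist' x2 <= 0.
  by move: Fb; rewrite -subr_le0 E2 pmulr_lle0 ?subr_gt0.
have x12 : x1 < x2 by rewrite (lt_trans x1c).
suff : line_sqdist' x1 < line_sqdist' x2 by rewrite ltNge (le_trans d2).
apply: line_sqdist'_lt => // [phi x1p px2|phi x1p px2].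
  by rewrite h0 ?(le_trans (ltW ax1))// (le_trans px2)// ltW.
by rewrite he ?(lt_trans ax1)// (lt_trans px2).
Qed.

End line.


(** * Convexity of planar discs *)

Section planar.
Context {R : realType}.
Implicit Types r u v phi t : R.

Definition polar_sqdist r phi : R := ln r ^+ 2 + phi ^+ 2.

Lemma polar_existence u v : 0 <= v -> 0 < u ^+ 2 + v ^+ 2 ->
  exists r phi, [/\ 0 < r, 0 <= phi <= pi, u = r * cos phi & v = r * sin phi].
Proof.
move=> v0 uv0; pose r := Num.sqrt (u ^+ 2 + v ^+ 2).
have r0 : 0 < r by rewrite sqrtr_gt0.
have r2 : r ^+ 2 = u ^+ 2 + v ^+ 2 by rewrite sqr_sqrtr// ltW.
have ur : -1 <= u / r <= 1.
  rewrite -ler_norml normrM normfV (gtr0_norm r0) ler_pdivrMr// mul1r.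
  rewrite -ler_sqr ?nnegrE ?(ltW r0)// real_normK ?num_real// r2.
  by rewrite lerDl sqr_ge0.
exists r, (acos (u / r)); split=> //.
- by rewrite acos_ge0 ?acos_lepi.
- by rewrite acosK ?in_itv//= mulrC divfK ?gt_eqF.
- rewrite sin_acos//; apply/eqP; rewrite -(@eqrXn2 _ 2) ?mulr_ge0 ?sqrtr_ge0 ?(ltW r0)//.
  rewrite exprMn r2 sqr_sqrtr.
    by rewrite expr_div_n r2; apply/eqP; field; rewrite gt_eqF.
  by move: ur; move: (u / r) => w; nra.
Qed.

Lemma lt_pihalf_cos_gt0 phi : 0 <= phi <= pi -> 0 < cos phi -> phi < pi / 2.
Proof.
move=> /andP[p0 ppi] c0; rewrite ltNge; apply/negP => p2.
by have := cos_le0_pihalf p2 ppi; lra.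
Qed.

Lemma line_recip_polar A B r phi : 0 < r ->
  A * (r * cos phi) + B * (r * sin phi) = 1 -> line_recip A B phi = r^-1.
Proof.
move=> r0 h; rewrite -[RHS]mul1r -h /line_recip; field.
by rewrite gt_eqF.
Qed.

Lemma line_sqdist_polar A B r phi : 0 < r ->
  A * (r * cos phi) + B * (r * sin phi) = 1 ->
  line_sqdist A B phi = polar_sqdist r phi.
Proof.
move=> r0 h; rewrite /line_sqdist (line_recip_polar r0 h) lnV ?posrE//.
by rewrite sqrrN.
Qed.

Lemma polar_sin_sub r1 phi1 r2 phi2 :
  r1 * r2 * sin (phi2 - phi1) =
  r2 * sin phi2 * (r1 * cos phi1) - r2 * cos phi2 * (r1 * sin phi1).
Proof. rewrite sinB; ring. Qed.

Lemma polar_lt_arg r1 phi1 r2 phi2 : 0 < r1 -> 0 < r2 ->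
  0 <= phi1 <= pi -> 0 <= phi2 <= pi ->
  r2 * cos phi2 * (r1 * sin phi1) < r2 * sin phi2 * (r1 * cos phi1) ->
  phi1 < phi2.
Proof.
move=> r10 r20 /andP[p1 p1pi] /andP[p2 p2pi]; rewrite -subr_gt0 -polar_sin_sub.
rewrite pmulr_rgt0 ?mulr_gt0// => s0; rewrite ltNge; apply/negP => p21.
have : 0 <= sin (phi1 - phi2) by rewrite sin_ge0_pi//; lra.
by rewrite -opprB sinN; lra.
Qed.

Lemma ln_between (a b t : R) : 0 < a -> 0 < b -> a != b -> 0 < t < 1 ->
  ln ((1 - t) * a + t * b) ^+ 2 < Num.max (ln a ^+ 2) (ln b ^+ 2).
Proof.
move=> a0 b0; wlog ab : a b t a0 b0 / a < b => [hw anb t01|_ /andP[t0 t1]].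
  case: (ltgtP a b) anb => // [ab _|ba _]; first by apply: hw; rewrite ?lt_eqF.
  rewrite maxC [X in ln X](_ : _ = (1 - (1 - t)) * b + (1 - t) * a); last by ring.
  by apply: hw; rewrite ?lt_eqF//; lra.
have ac : a < (1 - t) * a + t * b.
  by rewrite -subr_gt0 (_ : _ - a = t * (b - a)) ?mulr_gt0 ?subr_gt0//; ring.
have cb : (1 - t) * a + t * b < b.
  rewrite -subr_gt0 (_ : b - _ = (1 - t) * (b - a)) ?mulr_gt0 ?subr_gt0//; ring.
have c0 := lt_trans a0 ac.
have : ln a < ln ((1 - t) * a + t * b) by rewrite ltr_ln ?posrE.
have : ln ((1 - t) * a + t * b) < ln b by rewrite ltr_ln ?posrE.
move: (ln a) (ln b) (ln _) => p q s sq ps.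
rewrite lt_max; have [s0|s0] := leP 0 s; apply/orP; [right|left]; nra.
Qed.

(** Convexity of the disc of radius 1 in the half plane: through two points with
    distinct arguments there is a line, along which [line_sqdist] is
    quasiconvex as long as it stays at abscissas above [1 / e]. *)
Lemma planar_strictly_convex ra pa rb pb rc pc t :
  0 < ra -> 0 < rb -> 0 < rc ->
  0 <= pa < pi / 2 -> 0 <= pb < pi / 2 -> 0 <= pc < pi / 2 ->
  expR (- 1) <= ra * cos pa -> expR (- 1) <= rb * cos pb ->
  0 < t < 1 -> ra != rb \/ pa != pb ->
  rc * cos pc = (1 - t) * (ra * cos pa) + t * (rb * cos pb) ->
  rc * sin pc = (1 - t) * (ra * sin pa) + t * (rb * sin pb) ->
  polar_sqdist rc pc < Num.max (polar_sqdist ra pa) (polar_sqdist rb pb).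
Proof.
move=> ra0 rb0 rc0; have pi0 := @pi_gt0 R.
wlog pab : ra pa rb pb t ra0 rb0 / pa <= pb.
  move=> hw pa0 pb0 pc0 ea eb t01 ne ec es.
  have [pab|/ltW pba] := leP pa pb; first exact: (hw ra pa rb pb t).
  rewrite maxC; apply: (hw rb pb ra pa (1 - t)) => //; first by lra.
  - by case: ne => ne; [left|right]; rewrite eq_sym.
  - by rewrite ec; ring.
  - by rewrite es; ring.
move=> /andP[pa0 pa2] /andP[pb0 pb2] /andP[pc0 pc2] ea eb /andP[t0 t1] ne ec es.
have cac : 0 <= pa <= pi by lra.
have cbc : 0 <= pb <= pi by lra.
have ccc : 0 <= pc <= pi by lra.
move: pab; rewrite le_eqVlt => /predU1P[eab|pab].
  have rab : ra != rb by case: ne => //; rewrite eab eqxx.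
  have pcE : pc = pa.
    apply/eqP; rewrite eq_le !leNgt; apply/andP; split; apply/negP => h.
      have : 0 < ra * rc * sin (pc - pa).
        by rewrite mulr_gt0 ?mulr_gt0// sin_gt0_pi//; lra.
      by rewrite polar_sin_sub es ec -eab; lra.
    have : 0 < rc * ra * sin (pa - pc).
      by rewrite mulr_gt0 ?mulr_gt0// sin_gt0_pi//; lra.
    by rewrite polar_sin_sub es ec -eab; lra.
  have rcE : rc = (1 - t) * ra + t * rb.
    have c0 : 0 < cos pa by rewrite cos_gt0_pihalf//; lra.
    apply: (mulIf (lt0r_neq0 c0)); move: ec; rewrite pcE -eab => ->; ring.
  have := ln_between ra0 rb0 rab (introT andP (conj t0 t1)).
  by rewrite /polar_sqdist -rcE pcE -eab -addr_maxl ltrD2r.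
have sab : 0 < ra * rb * sin (pb - pa).
  by rewrite mulr_gt0 ?mulr_gt0// sin_gt0_pi//; lra.
have sabE := sab; rewrite polar_sin_sub in sabE.
have pac : pa < pc.
  apply: (@polar_lt_arg ra _ rc) => //; rewrite ec es -subr_gt0.
  rewrite (_ : _ - _ = t * (rb * sin pb * (ra * cos pa) - rb * cos pb * (ra * sin pa))).
    by rewrite mulr_gt0.
  by ring.
have pcb : pc < pb.
  apply: (@polar_lt_arg rc _ rb) => //; rewrite ec es -subr_gt0.
  rewrite (_ : _ - _ = (1 - t) * (rb * sin pb * (ra * cos pa) - rb * cos pb * (ra * sin pa))).
    by rewrite mulr_gt0// subr_gt0.
  by ring.
pose A := (rb * sin pb - ra * sin pa) / (ra * rb * sin (pb - pa)).
pose B := (ra * cos pa - rb * cos pb) / (ra * rb * sin (pb - pa)).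
have la : A * (ra * cos pa) + B * (ra * sin pa) = 1.
  by rewrite /A /B polar_sin_sub; field; rewrite gt_eqF.
have lb : A * (rb * cos pb) + B * (rb * sin pb) = 1.
  by rewrite /A /B polar_sin_sub; field; rewrite gt_eqF.
have lc : A * (rc * cos pc) + B * (rc * sin pc) = 1.
  rewrite ec es; transitivity ((1 - t) * (A * (ra * cos pa) + B * (ra * sin pa)) +
    t * (A * (rb * cos pb) + B * (rb * sin pb))); first by ring.
  by rewrite la lb; ring.
rewrite -(line_sqdist_polar ra0 la) -(line_sqdist_polar rb0 lb).
rewrite -(line_sqdist_polar rc0 lc); apply: line_sqdist_quasiconvex => //.
  move=> phi ap pb'; apply: (@line_recip_gt0 _ _ _ pa pb) => //; first by lra.
    by rewrite (line_recip_polar ra0 la) invr_gt0.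
  by rewrite (line_recip_polar rb0 lb) invr_gt0.
move=> phi ap pb'.
have shiftE psi : line_recip (A - expR 1) B psi = line_recip A B psi - expR 1 * cos psi.
  by rewrite /line_recip; ring.
have e0 := expR_gt0 (1 : R).
have end_le r psi : 0 < r -> expR (- 1) <= r * cos psi -> r^-1 - expR 1 * cos psi <= 0.
  move=> r0; rewrite expRN subr_le0 => h; rewrite -(ler_pM2l r0) divff ?gt_eqF//.
  by rewrite mulrCA -ler_pdivrMl// mulr1.
have : line_recip (A - expR 1) B phi <= 0.
  apply: (@line_recip_le0 _ _ _ pa pb) => //; first by lra.
  - exact: ltW.
  - exact: ltW.
  - by rewrite shiftE (line_recip_polar ra0 la) end_le.
  - by rewrite shiftE (line_recip_polar rb0 lb) end_le.
rewrite shiftE subr_le0 => /le_lt_trans; apply.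
have phi0 : 0 < phi by exact: le_lt_trans ap.
have phipi : phi <= pi by rewrite (le_trans (ltW pb'))//; case/andP: cbc.
by rewrite gtr_pMr// -cos0 ltr_cos// in_itv/= ?lexx ?pi_ge0 ?(ltW phi0).
Qed.

(** By symmetry the derivative of [line_sqdist] along a vertical line vanishes at
    the angle 0, and it increases from there on as long as the abscissa is at
    least [1 / e]. *)
Lemma vertical_lt r1 phi1 r2 phi2 : 0 < r1 -> 0 < r2 ->
  0 <= phi1 < pi / 2 -> 0 <= phi2 < pi / 2 ->
  expR (- 1) <= r1 * cos phi1 -> r1 * cos phi1 = r2 * cos phi2 ->
  r1 * sin phi1 < r2 * sin phi2 -> polar_sqdist r1 phi1 < polar_sqdist r2 phi2.
Proof.
move=> r10 r20 /andP[p10 p12] /andP[p20 p22] e1 ec es; have pi0 := @pi_gt0 R.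
have u0 : 0 < r1 * cos phi1 by rewrite (lt_le_trans _ e1)// expR_gt0.
have p12' : phi1 < phi2.
  apply: (@polar_lt_arg r1 _ r2) => //; try lra.
  by rewrite -ec mulrC ltr_pM2r.
pose A := (r1 * cos phi1)^-1.
have A0 : 0 < A by rewrite invr_gt0.
have Ae : A <= expR 1.
  by rewrite -[leRHS]invrK -expRN lef_pV2 ?posrE// expR_gt0.
have l1 : A * (r1 * cos phi1) + 0 * (r1 * sin phi1) = 1.
  by rewrite mul0r addr0 mulVf// gt_eqF.
have l2 : A * (r2 * cos phi2) + 0 * (r2 * sin phi2) = 1.
  by rewrite mul0r addr0 -ec mulVf// gt_eqF.
rewrite -(line_sqdist_polar r10 l1) -(line_sqdist_polar r20 l2).
have hE psi : line_recip A 0 psi = A * cos psi.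
  by rewrite /line_recip mul0r addr0.
have h0 psi : 0 <= psi -> psi <= phi2 -> 0 < line_recip A 0 psi.
  by move=> s0 s2; rewrite hE mulr_gt0// cos_gt0_pihalf//; lra.
have he psi : 0 < psi -> psi < phi2 -> line_recip A 0 psi < expR 1.
  move=> s0 s2; rewrite hE (lt_le_trans _ Ae)// gtr_pMr//.
  by rewrite -cos0 ltr_cos ?in_itv//=; lra.
apply: (is_derive_lt p12') => [psi /andP[s1 s2]|psi /andP[s1 s2]].
  by apply: is_derive_line_sqdist; rewrite h0// (le_trans p10).
have s0 : 0 < psi by rewrite (le_lt_trans p10).
have d0 : line_sqdist' A 0 0 = 0.
  rewrite /line_sqdist' /line_recip' sin0 mul0r mulr0 subrr mulr0 mul0r.
  by rewrite addr0 mulr0.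
have := @line_sqdist'_lt _ A 0 _ _ s0; rewrite d0.
apply=> xi xi0 xis; first by rewrite h0// (le_trans xis)// ltW.
by rewrite he// (lt_trans xis).
Qed.

Lemma vertical_le r1 phi1 r2 phi2 : 0 < r1 -> 0 < r2 ->
  0 <= phi1 < pi / 2 -> 0 <= phi2 < pi / 2 ->
  expR (- 1) <= r1 * cos phi1 -> r1 * cos phi1 = r2 * cos phi2 ->
  r1 * sin phi1 <= r2 * sin phi2 -> polar_sqdist r1 phi1 <= polar_sqdist r2 phi2.
Proof.
move=> r10 r20 p1 p2 e1 ec; rewrite le_eqVlt => /predU1P[es|es]; last first.
  exact/ltW/vertical_lt.
have sq r p : r ^+ 2 = (r * cos p) ^+ 2 + (r * sin p) ^+ 2.
  by rewrite !exprMn -mulrDr cos2Dsin2 mulr1.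
have r12 : r1 = r2.
  by apply/eqP; rewrite -(@eqrXn2 _ 2) ?(ltW r10) ?(ltW r20)// (sq r1 phi1) (sq r2 phi2) ec es.
have pi0 := @pi_gt0 R.
have p12 : phi1 = phi2.
  apply: cos_inj; rewrite ?in_itv/=; try lra.
  by apply: (mulfI (lt0r_neq0 r20)); rewrite -ec r12.
by rewrite r12 p12.
Qed.

(** With [y = 1 - sqrt (1 - phi ^ 2)] the radius is at least [exp (y - 1)] and
    [cos phi >= 1 - phi ^ 2 / 2 = 1 - y + y ^ 2 / 2 >= exp (- y)]. *)
Lemma polar_abscissa_ge r phi : 0 < r -> 0 <= phi -> polar_sqdist r phi <= 1 ->
  expR (- 1) <= r * cos phi.
Proof.
move=> r0 p0 F1; have := sqr_ge0 (ln r); have := sqr_ge0 phi => p2 l2.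
have p1 : phi ^+ 2 <= 1 by move: F1; rewrite /polar_sqdist; lra.
pose s := Num.sqrt (1 - phi ^+ 2); have s0 : 0 <= s by exact: sqrtr_ge0.
have s2 : s ^+ 2 = 1 - phi ^+ 2 by rewrite sqr_sqrtr// subr_ge0.
have s1 : s <= 1 by rewrite -(@ler_pXn2r _ 2) ?nnegrE// s2 expr1n; lra.
have lnr : - s <= ln r.
  suff : `|ln r| <= s by rewrite ler_norml => /andP[].
  rewrite -ler_sqr ?nnegrE// real_normK ?num_real// s2.
  by move: F1; rewrite /polar_sqdist; lra.
have rs : expR (- s) <= r by rewrite -[leRHS]lnK ?posrE// ler_expR.
have y0 : 0 <= 1 - s by lra.
have cy : expR (- (1 - s)) <= cos phi.
  apply: le_trans (cos_ge_quadratic phi).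
  have := expRN_taylor 3 y0; cbv [expN_sum monomial].
  have -> : phi ^+ 2 = 1 - s ^+ 2 by lra.
  by move: (expR _) => E; lra.
have -> : expR (- 1) = expR (- s) * expR (- (1 - s)) by rewrite -expRD; congr expR; ring.
by apply: ler_pM; rewrite ?expR_ge0.
Qed.

End planar.


(** * Lines through the centre *)

Section star_line.
Context {R : realType} (B : R).

Local Notation h := (line_recip 1 B).
Local Notation F := (line_sqdist 1 B).
Local Notation F' := (line_sqdist' 1 B).

(** A line passes through the point 1 exactly when [A = 1], and then
    [line_recip' * sin = line_recip * cos - 1]. *)
Lemma star_line (phi : R) : 0 < h phi ->
  star (- ln (h phi)) phi = sin phi * F' phi / 2.
Proof.
move=> h0; rewrite /star -lnV ?posrE// lnK ?posrE ?invr_gt0// lnV ?posrE//.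
have -> : sin phi * F' phi / 2 =
    phi * sin phi + ln (h phi) * (line_recip' 1 B phi * sin phi) / h phi.
  by rewrite /line_sqdist'; field; rewrite gt_eqF.
have -> : line_recip' 1 B phi * sin phi = h phi * cos phi - 1.
  have := cos2Dsin2 phi; rewrite /line_recip' /line_recip => e.
  by rewrite !mul1r -e; ring.
by field; rewrite gt_eqF.
Qed.

Variable q : R.
Hypothesis q_ge : 5 / 2 <= q.
Hypothesis q_le : q <= 27 / 10.
Hypothesis qE : tangency q = expR (- 1).

Let sqdist'_gt0 (phi : R) : 0 < phi -> phi < pi -> 0 < h phi ->
  F phi <= 1 + q ^+ 2 -> h phi != expR 1 \/ phi != q -> 0 < F' phi.
Proof.
move=> p0 ppi h0 Fq ne.
have : 0 < star (- ln (h phi)) phi.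
  apply: (star_gt0 q_ge q_le qE) => //; rewrite ?(ltW p0)//.
  - by rewrite ltr_wpDl ?sqr_ge0// exprn_gt0.
  - by rewrite sqrrN.
  - case: ne => [he|]; [left|by right].
    apply: contra he => /eqP/oppr_inj he.
    by apply/eqP; rewrite -[LHS]lnK ?posrE// he.
rewrite star_line// => H; have s0 : 0 < sin phi by rewrite sin_gt0_pi// p0.
by move: H; rewrite -mulrA pmulr_rgt0// pmulr_lgt0// invr_gt0.
Qed.

(** The tangency point [(-1, q)] is an inflection point: just before it the line
    is inside the disc of radius [1 / e], where [line_sqdist] is concave. *)
Let sqdist_lt_exceptional (a : R) : 0 <= a -> a < q -> 0 < h a ->
  F q = 1 + q ^+ 2 -> h q = expR 1 -> exists2 c, a <= c < q & F c < F q.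
Proof.
move=> a0 aq ha Fq hq; have q5 := q_ge; have q3 := q_le; have pi3 := @pi_gt3 R.
have sq0 : 0 < sin q by rewrite sin_gt0_pi//; lra.
have hq0 : 0 < h q by rewrite hq expR_gt0.
have F'q : F' q = 0.
  have := star_line hq0; rewrite hq expRK /star.
  have := qE; rewrite /tangency => qE'.
  have -> : -1 * expR (-1) - -1 * cos q + q * sin q = 0 by lra.
  move=> /esym/eqP; rewrite mulf_eq0 invr_eq0 pnatr_eq0 orbF mulf_eq0 (gt_eqF sq0).
  by move=> /eqP.
have h'q : line_recip' 1 B q = - (q * expR 1).
  have e0 := expR_gt0 (1 : R); move: F'q; rewrite /line_sqdist' hq expRK mul1r => /eqP.
  move: (line_recip' 1 B q) => k; rewrite mulf_eq0 pnatr_eq0/= addr_eq0 => /eqP ->.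
  by rewrite mulNr divfK ?opprK ?gt_eqF.
have hE t : h (q - t) = expR 1 * (cos t + q * sin t).
  have -> : h (q - t) = h q * cos t - line_recip' 1 B q * sin t.
    by rewrite /line_recip /line_recip' cosB sinB; ring.
  by rewrite hq h'q; ring.
pose c := Num.max a (q - 1).
have ac : a <= c by rewrite le_max lexx.
have cq : c < q by rewrite gt_max aq/=; lra.
have qc1 : q - 1 <= c by rewrite le_max lexx orbT.
exists c; first by rewrite ac.
have hpos phi : c <= phi -> phi <= q -> 0 < h phi.
  move=> cp pq; apply: (@line_recip_gt0 _ _ _ a q) => //; last exact: le_trans cp.
  by lra.
have hbig phi : c <= phi -> phi < q -> expR 1 < h phi.
  move=> cp pq; have -> : phi = q - (q - phi) by ring.
  rewrite hE ltr_pMr ?expR_gt0//; pose t := q - phi; rewrite -/t.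
  have t0 : 0 < t by rewrite subr_gt0.
  have t1 : t <= 1 by rewrite /t; lra.
  have cost := cos_ge_quadratic t.
  have t2 : t ^+ 2 <= t by rewrite expr2 ler_piMl// ltW.
  have sint : t * cos t <= sin t by rewrite mulr_cos_le_sin//; lra.
  have : t * (1 / 2) <= t * cos t by rewrite ler_wpM2l ?(ltW t0)//; lra.
  have : 5 / 2 * sin t <= q * sin t by rewrite ler_wpM2r ?sin_ge0_pi//; lra.
  by lra.
apply: (is_derive_lt cq) => [phi /andP[cp pq]|phi /andP[cp pq]].
  by apply: is_derive_line_sqdist; exact: hpos.
rewrite -F'q -ltrN2.
have dN x (cx : phi <= x <= q) := is_deriveN
  (is_derive_line_sqdist' (hpos x (le_trans (ltW cp) (andP cx).1) (andP cx).2)).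
apply: (is_derive_lt pq dN) => x /andP[px xq].
have cx := lt_trans cp px.
rewrite oppr_gt0 pmulr_rlt0; last by rewrite mulr_gt0// ltr_pwDl// sqr_ge0.
by rewrite subr_lt0 -[ltLHS]expRK ltr_ln ?posrE ?expR_gt0 ?hpos ?hbig// ltW.
Qed.

(** If an earlier value were at least as large, then the minimum over [[a, b]]
    would be reached at a point other than [a], where the derivative would have to
    be nonpositive. By [star_gt0] it is positive there, unless the point is the
    inflection point, where the previous lemma applies. *)
Lemma line_sqdist_lt (a b : R) : 0 <= a -> a < b -> b < pi ->
  (forall phi, 0 <= phi -> phi <= b -> 0 < h phi) ->
  F b <= 1 + q ^+ 2 -> F a < F b.
Proof.
move=> a0 ab bpi hpos Fb; rewrite ltNge; apply/negP => Fba.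
have b0 : 0 < b by exact: le_lt_trans ab.
have cF : {within `[a, b], continuous F}.
  apply: derivable_within_continuous => x; rewrite in_itv/= => /andP[ax xb].
  by case: (is_derive_line_sqdist (hpos x (le_trans a0 ax) xb)).
have [c0 /[!in_itv]/= /andP[ac0 c0b] c0min] := EVT_min (ltW ab) cF.
have noncritical c : a < c -> c <= b ->
    (forall t, a <= t -> t <= b -> F c <= F t) -> ~ 0 < F' c.
  move=> ac cb cmin; have hc : 0 < h c by rewrite hpos// (le_trans a0)// ltW.
  move=> /(is_derive_gt0_near (is_derive_line_sqdist hc))[+ _] => nearc.
  have : \forall y \near c^'-, F c <= F y.
    near=> y; have yc : y < c by near: y; exact: nbhs_left_lt.
    rewrite cmin//; last by rewrite (le_trans _ cb)// ltW.
    by near: y; exact: nbhs_left_ge.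
  move=> nearc'; suff /filter_ex[] : \forall y \near c^'-, False by [].
  by apply: filterS2 nearc nearc' => y; rewrite ltNge => /negbTE ->.
have [c [ac cb cmin]] : exists c, [/\ a < c, c <= b &
    forall t, a <= t -> t <= b -> F c <= F t].
  move: ac0; rewrite le_eqVlt => /predU1P[ac|ac0]; last first.
    by exists c0; split=> // t at_ tb; rewrite c0min// in_itv/= at_.
  exists b; split=> // t at_ tb; rewrite (le_trans Fba)// ac c0min//.
  by rewrite in_itv/= at_.
have Fc := le_trans (cmin b (ltW ab) (lexx b)) Fb.
have c0' : 0 < c by exact: le_lt_trans ac.
have cpi : c < pi by exact: le_lt_trans bpi.
have hc : 0 < h c by rewrite hpos// ltW.
have [ne|] := boolP ((h c != expR 1) || (c != q)).
  by apply: (noncritical c) => //; apply: sqdist'_gt0 => //; apply/orP.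
rewrite negb_or !negbK => /andP[/eqP hce /eqP cq].
have FcE : F c = 1 + q ^+ 2 by rewrite /line_sqdist hce expRK expr1n cq.
have cbE : c = b.
  apply/eqP; rewrite eq_le cb leNgt; apply/negP => ltcb.
  apply: (noncritical b) => //.
    by move=> t at_ tb; rewrite (le_trans Fb)// -FcE cmin.
  apply: sqdist'_gt0 => //; first by rewrite hpos// ltW.
  by right; rewrite -cq gt_eqF.
have aq : a < q by rewrite -cq.
have ha : 0 < h a by rewrite hpos// ltW.
have [||c' /andP[ac' c'q]] := sqdist_lt_exceptional a0 aq ha.
- by rewrite -FcE cq.
- by rewrite -hce cq.
by rewrite -cq ltNge cmin// -cbE cq ltW.
Unshelve. all: by end_near. Qed.

End star_line.


(** * Topology of the balls *)

Section cone_ball.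
Context {R : realType} {n : nat}.
Implicit Types x y z v : 'rV[R]_n.

Lemma sqr_cone_distE x z : x != 0 -> z != 0 ->
  cone_dist x z ^+ 2 = polar_sqdist (enorm z / enorm x) (angle x z).
Proof.
move=> /enorm_gt0 x0 /enorm_gt0 z0; rewrite sqr_cone_dist /polar_sqdist.
by rewrite ln_div ?posrE// -(opprB (ln (enorm z))) sqrrN addrC.
Qed.

Lemma cone_dist_polar (e1 e2 : 'rV[R]_n) (s r phi : R) : orthonormal2 e1 e2 ->
  0 < s -> 0 < r -> 0 <= phi <= pi ->
  cone_dist (polar e1 e2 s 0) (polar e1 e2 (s * r) phi) ^+ 2 =
  polar_sqdist r phi.
Proof.
move=> e12 s0 r0 p0; have sr0 : 0 < s * r by exact: mulr_gt0.
rewrite sqr_cone_distE ?polar_neq0// !enorm_polar ?ltW// angle_polar//.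
by congr polar_sqdist; field; rewrite gt_eqF.
Qed.

Lemma cone_dist_small z (e : R) : z != 0 -> 0 < e ->
  exists2 d, 0 < d & forall v, enorm (v - z) < d -> v != 0 /\ cone_dist z v < e.
Proof.
move=> z0 e0; have r0 := enorm_gt0 z0; set r := enorm z in r0.
exists (Num.min (r / 4) (e * r / 4)).
  by rewrite lt_min divr_gt0//= divr_gt0// mulr_gt0.
move=> v; rewrite lt_min enormBC => /andP[d1 d2].
have d0 := enorm_ge0 (z - v); have zr : enorm z = r by [].
have v0 : v != 0.
  by apply: contraTneq d1 => ->; rewrite subr0 zr -leNgt; lra.
split=> //; have small : 2 * enorm (z - v) < enorm z by rewrite zr; lra.
apply: le_lt_trans (cone_dist_local z0 v0 small) _.
by rewrite ltr_pdivrMr zr; nra.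
Qed.

Lemma cone_ball_open x z (M : R) : x != 0 -> z != 0 -> cone_dist x z < M ->
  interior [set v | v != 0 /\ cone_dist x v < M] z.
Proof.
move=> x0 z0 zM; have e0 : 0 < M - cone_dist x z by rewrite subr_gt0.
have [d d0 hd] := cone_dist_small z0 e0.
apply/nbhs_enormP; exists d => // v /hd[v0 zv]; split=> //.
by have := cone_dist_triangle x0 z0 v0; lra.
Qed.

Lemma enorm_cone_ball x z (M : R) : x != 0 -> z != 0 -> cone_dist x z < M ->
  enorm x * expR (- M) < enorm z < enorm x * expR M.
Proof.
move=> x0 z0; have xn := enorm_gt0 x0; have zn := enorm_gt0 z0.
move=> /(le_lt_trans (ln_le_cone_dist x z)); rewrite ltr_norml => /andP[l1 l2].
have expE m : enorm x * expR m = expR (ln (enorm x) + m) by rewrite expRD lnK.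
have zE : enorm z = expR (ln (enorm z)) by rewrite lnK.
by rewrite !expE [enorm z]zE !ltr_expR; lra.
Qed.

Lemma closure_cone_ball x z (M : R) : x != 0 ->
  closure [set v | v != 0 /\ cone_dist x v < M] z ->
  z != 0 /\ cone_dist x z <= M.
Proof.
move=> x0 cz; have xn := enorm_gt0 x0.
have z0 : z != 0.
  have e0 : 0 < enorm x * expR (- M) by rewrite mulr_gt0 ?expR_gt0.
  have [a [a0 aM] az] := closure_enorm cz e0.
  apply: contraTneq az => ->; rewrite subr0 -leNgt.
  by have /andP[/ltW] := enorm_cone_ball x0 a0 aM.
split=> //; apply/ler_addgt0Pr => e e0.
have [d d0 hd] := cone_dist_small z0 e0.
have [a [a0 aM] /hd[_ za]] := closure_enorm cz d0.
by have := cone_dist_triangle x0 a0 z0; rewrite (cone_distC a); lra.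
Qed.

End cone_ball.

(** * Strict convexity for radius at most 1 *)

Section convexity.
Context {R : realType} {n : nat}.
Implicit Types x y z a b : 'rV[R]_n.

Let dotx0 x : dot x 0 = 0.
Proof. by rewrite /dot big1// => i _; rewrite mxE mulr0. Qed.

Definition perp x z := z - (dot x z / dot x x) *: x.

Let dotxx_gt0 x : x != 0 -> 0 < dot x x.
Proof. by move=> /enorm_gt0 x0; rewrite -sqr_enorm exprn_gt0. Qed.

Lemma perp_conv x a b (t : R) : x != 0 ->
  perp x ((1 - t) *: a + t *: b) = (1 - t) *: perp x a + t *: perp x b.
Proof.
move=> x0; rewrite /perp !dotE; apply/rowP => i; rewrite !mxE.
by field; rewrite gt_eqF// dotxx_gt0.
Qed.

Lemma enorm_perp x z : x != 0 -> z != 0 ->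
  enorm (perp x z) = enorm z * sin (angle x z).
Proof.
move=> x0 z0; apply/eqP; rewrite -(@eqrXn2 _ 2) ?mulr_ge0 ?enorm_ge0//; last first.
  by rewrite sin_ge0_pi// angle_itv.
have xx := dotxx_gt0 x0; have xn := enorm_gt0 x0.
rewrite sqr_enorm /perp !dotE (dotC z x) exprMn sin2cos2.
have -> : dot z z = enorm z ^+ 2 by rewrite sqr_enorm.
rewrite cos_angle// -(sqr_enorm x); apply/eqP; field.
by rewrite gt_eqF.
Qed.

(** The last term is what makes the Euclidean norm strictly convex. *)
Lemma sqr_enorm_conv (a b : 'rV[R]_n) (t : R) :
  enorm ((1 - t) *: a + t *: b) ^+ 2 =
  (1 - t) * enorm a ^+ 2 + t * enorm b ^+ 2 - t * (1 - t) * enorm (a - b) ^+ 2.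
Proof. by rewrite !sqr_enorm !dotE (dotC b a); ring. Qed.

(** The abscissa along [x] is affine and the distance from the axis is convex, so
    in polar coordinates with axis [x] the segment is under the chord of the
    images of its end points, and strictly under it if they coincide. *)
Lemma cone_dist_strictly_convex x a b (M t : R) : x != 0 -> a != 0 -> b != 0 ->
  M <= 1 -> cone_dist x a <= M -> cone_dist x b <= M -> a != b -> 0 < t < 1 ->
  (1 - t) *: a + t *: b != 0 /\ cone_dist x ((1 - t) *: a + t *: b) < M.
Proof.
move=> x0 a0 b0 M1 aM bM ab /andP[t0 t1]; have xn := enorm_gt0 x0.
have M0 : 0 <= M by rewrite (le_trans _ aM)// cone_dist_ge0.
pose s := enorm x; pose r z := enorm z / s; pose p z := angle x z.
have s0 : 0 < s by [].
have r_gt0 z : z != 0 -> 0 < r z by move=> /enorm_gt0 zn; rewrite divr_gt0.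
have fM z : z != 0 -> cone_dist x z <= M -> polar_sqdist (r z) (p z) <= M ^+ 2.
  by move=> z0 zM; rewrite -sqr_cone_distE// ler_sqr ?nnegrE ?cone_dist_ge0.
have abs z : z != 0 -> r z * cos (p z) = dot x z / s ^+ 2.
  by move=> z0; rewrite cos_angle// /r /p -/s; field; rewrite gt_eqF.
have ord z : z != 0 -> r z * sin (p z) = enorm (perp x z) / s.
  by move=> z0; rewrite enorm_perp// /r /p; field; rewrite gt_eqF.
have M2 : M ^+ 2 <= 1 by rewrite expr_le1.
have abs_ge z : z != 0 -> cone_dist x z <= M -> expR (- 1) <= r z * cos (p z).
  move=> z0 zM; apply: polar_abscissa_ge; [exact: r_gt0| |].
    by have /andP[] := angle_itv x z.
  exact: le_trans (fM _ z0 zM) M2.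
have [ea eb] := (abs_ge _ a0 aM, abs_ge _ b0 bM).
have e0 := expR_gt0 (- 1 : R).
set c := (1 - t) *: a + t *: b.
have dotc : dot x c / s ^+ 2 = (1 - t) * (r a * cos (p a)) + t * (r b * cos (p b)).
  by rewrite !abs// /c !dotE; ring.
have ec : expR (- 1) <= dot x c / s ^+ 2.
  rewrite dotc; have h1 : (1 - t) * expR (- 1) <= (1 - t) * (r a * cos (p a)).
    by rewrite ler_wpM2l//; lra.
  have h2 : t * expR (- 1) <= t * (r b * cos (p b)) by rewrite ler_wpM2l// ltW.
  by lra.
have c0 : c != 0.
  apply/eqP => cE; move: ec; rewrite cE dotx0 mul0r.
  by rewrite leNgt e0.
split=> //; have absc := abs _ c0.
have acute z : expR (- 1) <= r z * cos (p z) -> z != 0 -> 0 <= p z < pi / 2.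
  move=> ez z0; have pz := angle_itv x z; rewrite lt_pihalf_cos_gt0//.
    by case/andP: pz => ->.
  by rewrite -(pmulr_rgt0 _ (r_gt0 _ z0)) (lt_le_trans e0).
have [pa pb] := (acute _ ea a0, acute _ eb b0).
have pc : 0 <= p c < pi / 2 by apply: acute => //; rewrite absc.
rewrite -ltr_sqr ?nnegrE ?cone_dist_ge0// sqr_cone_distE// -/s -/(r c) -/(p c).
pose v := (1 - t) * (r a * sin (p a)) + t * (r b * sin (p b)).
have vE : v = ((1 - t) * enorm (perp x a) + t * enorm (perp x b)) / s.
  by rewrite /v !ord//; ring.
have [/andP[/eqP rab /eqP pab]|ne] := boolP ((r a == r b) && (p a == p b)).
  apply: lt_le_trans (fM _ a0 aM).
  have sN : s^-1 != 0 by rewrite invr_neq0// gt_eqF.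
  have s2N : (s ^+ 2)^-1 != 0 by rewrite invr_neq0// expf_neq0// gt_eqF.
  have dab : dot x a = dot x b by apply: (mulIf s2N); rewrite -!abs// rab pab.
  have perpab : enorm (perp x a) = enorm (perp x b).
    by apply: (mulIf sN); rewrite -!ord// rab pab.
  have perp_ne : 0 < enorm (perp x a - perp x b) ^+ 2.
    rewrite exprn_gt0// enorm_gt0// subr_eq0.
    by apply: contra ab; rewrite /perp dab => /eqP/addIr ->.
  apply: vertical_lt => //; rewrite ?r_gt0 ?absc//.
    by rewrite dotc rab pab; ring.
  rewrite !ord// ltr_pM2r ?invr_gt0// perp_conv//.
  rewrite -ltr_sqr ?nnegrE ?enorm_ge0// sqr_enorm_conv -perpab.
  have : 0 < t * (1 - t) * enorm (perp x a - perp x b) ^+ 2.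
    by apply: mulr_gt0 => //; apply: mulr_gt0 => //; rewrite subr_gt0.
  by lra.
have v0 : 0 <= v.
  by rewrite vE divr_ge0 ?addr_ge0 ?mulr_ge0 ?enorm_ge0 ?subr_ge0 ?ltW.
have uv0 : 0 < (dot x c / s ^+ 2) ^+ 2 + v ^+ 2.
  by rewrite ltr_pwDl ?sqr_ge0// exprn_gt0// (lt_le_trans e0).
have [r' [p' [r'0 p'pi uE v'E]]] := polar_existence v0 uv0.
have p'2 : 0 <= p' < pi / 2.
  rewrite lt_pihalf_cos_gt0//; first by case/andP: p'pi => ->.
  by rewrite -(pmulr_rgt0 _ r'0) -uE (lt_le_trans e0).
apply: (@le_lt_trans _ _ (polar_sqdist r' p')).
  apply: vertical_le => //; rewrite ?r_gt0 ?absc// -v'E ord// vE.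
  rewrite ler_pM2r ?invr_gt0// perp_conv// (le_trans (enormD _ _))// !enormZ.
  by rewrite !ger0_norm ?subr_ge0 ?(ltW t0) ?(ltW t1).
apply: (@lt_le_trans _ _ (Num.max (polar_sqdist (r a) (p a)) (polar_sqdist (r b) (p b)))).
  apply: (planar_strictly_convex (t := t)); rewrite ?r_gt0 ?t0 -?uE -?v'E//.
  by apply/orP; rewrite -negb_and.
by rewrite ge_max !fM.
Qed.

End convexity.


(** * Starlikeness *)

Section starlikeness.
Context {R : realType} {n : nat}.
Hypothesis n2 : (2 <= n)%N.
Implicit Types x y z : 'rV[R]_n.

Variable q : R.
Hypothesis q_ge : 5 / 2 <= q.
Hypothesis q_le : q <= 27 / 10.
Hypothesis qE : tangency q = expR (- 1).

Lemma polar_conv (e1 e2 : 'rV[R]_n) (s0 r phi r1 phi1 s : R) :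
  r1 * cos phi1 = (1 - s) + s * (r * cos phi) ->
  r1 * sin phi1 = s * (r * sin phi) ->
  polar e1 e2 (s0 * r1) phi1 =
  (1 - s) *: polar e1 e2 s0 0 + s *: polar e1 e2 (s0 * r) phi.
Proof.
move=> ec es; apply/rowP => i; rewrite !mxE cos0 sin0.
transitivity (s0 * ((r1 * cos phi1) * e1 ord0 i + (r1 * sin phi1) * e2 ord0 i)).
  by ring.
by rewrite ec es; ring.
Qed.

(** In the plane of [x] and [z] the segment is a piece of a line through the point
    1 parametrized by the angle, to which [line_sqdist_lt] applies, unless [z] is
    a positive multiple of [x]; the latter case is the monotony of the
    logarithm. *)
Lemma cone_dist_segment_lt x z (s : R) : x != 0 -> z != 0 -> z != x ->
  cone_dist x z ^+ 2 <= 1 + q ^+ 2 -> 0 <= s < 1 ->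
  (1 - s) *: x + s *: z != 0 /\
  cone_dist x ((1 - s) *: x + s *: z) < cone_dist x z.
Proof.
move=> x0 z0 zx Fq /andP[s0 s1]; have q5 := q_ge; have q3 := q_le.
have [e1 [e2 [e12 xE zE]]] := polar_frame n2 x0 z0.
have X0 := enorm_gt0 x0; have Z0 := enorm_gt0 z0.
set X := enorm x in X0 xE; set phi := angle x z in zE.
pose r := enorm z / X; have r0 : 0 < r by rewrite divr_gt0.
have ZE : enorm z = X * r by rewrite /r mulrC divfK// gt_eqF.
rewrite ZE in zE; have /andP[p0 ppi] : 0 <= phi <= pi by exact: angle_itv.
have Kz : cone_dist x z ^+ 2 = polar_sqdist r phi by rewrite sqr_cone_distE.
clearbody phi r X.
have p_lt : phi < pi.
  apply: lt_trans (@pi_gt3 R); rewrite -ltr_sqr ?nnegrE//.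
  have := sqr_ge0 (ln r); have : q ^+ 2 <= (27 / 10) ^+ 2.
    by rewrite ler_sqr ?nnegrE//; lra.
  by move: Fq; rewrite Kz /polar_sqdist; lra.
suff [r1 [phi1 [r10 p1 lt1 ec es]]] : exists r1 phi1 : R,
    [/\ 0 < r1, 0 <= phi1 <= pi, polar_sqdist r1 phi1 < polar_sqdist r phi,
      r1 * cos phi1 = (1 - s) + s * (r * cos phi) &
      r1 * sin phi1 = s * (r * sin phi)].
  have yE := polar_conv e1 e2 X ec es; rewrite -xE -zE in yE; rewrite -yE.
  split; first by rewrite polar_neq0// mulr_gt0.
  rewrite -ltr_sqr ?nnegrE ?cone_dist_ge0// Kz {1}xE cone_dist_polar//.
move: p0; rewrite le_eqVlt => /predU1P[p0|p0].
  have r1 : 1 != r.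
    by apply: contra zx => /eqP r1; rewrite zE xE -p0 -r1 mulr1.
  exists ((1 - s) * 1 + s * r), 0; rewrite -p0 /polar_sqdist expr0n addr0.
  split.
  - move: s0; rewrite le_eqVlt => /predU1P[<-|s0].
      by rewrite subr0 mul0r addr0 mulr1.
    by rewrite ltr_wpDl ?mulr_gt0// mulr1 subr_ge0 ltW.
  - by rewrite lexx pi_ge0.
  - have lr : 0 < ln r ^+ 2.
      by rewrite exprn_even_gt0//= ln_eq0// eq_sym.
    rewrite addr0; move: s0; rewrite le_eqVlt => /predU1P[<-|s0].
      by rewrite subr0 mul0r addr0 mulr1 ln1 expr0n.
    have := ln_between ltr01 r0 r1 (introT andP (conj s0 s1)).
    by rewrite ln1 expr0n/= max_r// ltW.
  - by rewrite cos0 !mulr1.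
  - by rewrite sin0 !mulr0.
move: s0; rewrite le_eqVlt => /predU1P[<-|s0].
  exists 1, 0; rewrite subr0 !mul0r addr0 cos0 sin0 mul1r mulr0; split=> //.
    by rewrite lexx pi_ge0.
  rewrite /polar_sqdist ln1 expr0n/= addr0.
  by rewrite ltr_wpDl ?sqr_ge0// exprn_gt0.
have sp : 0 < sin phi by rewrite sin_gt0_pi// p0.
have v0 : 0 < s * (r * sin phi) by rewrite !mulr_gt0.
have uv0 : 0 < ((1 - s) + s * (r * cos phi)) ^+ 2 + (s * (r * sin phi)) ^+ 2.
  by rewrite ltr_wpDl ?sqr_ge0// exprn_gt0.
have [r1 [phi1 [r10 /andP[p10 p1pi] uE vE]]] := polar_existence (ltW v0) uv0.
exists r1, phi1; split=> //; first by rewrite p10.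
have p1p : phi1 < phi.
  apply: (@polar_lt_arg _ r1 _ r) => //; rewrite ?p10 ?(ltW p0)//.
  rewrite -uE -vE -subr_gt0.
  have : 0 < (1 - s) * (r * sin phi) by rewrite !mulr_gt0// subr_gt0.
  by lra.
pose B := (1 - r * cos phi) / (r * sin phi).
have l : 1 * (r * cos phi) + B * (r * sin phi) = 1.
  by rewrite /B divfK ?gt_eqF ?mulr_gt0// mul1r addrC subrK.
have l1 : 1 * (r1 * cos phi1) + B * (r1 * sin phi1) = 1.
  rewrite -uE -vE; have : B * (r * sin phi) = 1 - r * cos phi by lra.
  by move=> BE; rewrite (mulrCA B) BE; ring.
rewrite -(line_sqdist_polar r0 l) -(line_sqdist_polar r10 l1).
apply: (line_sqdist_lt q_ge q_le qE) => //.
  move=> t t0 tp; apply: (@line_recip_gt0 _ _ _ 0 phi) => //.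
  - by rewrite subr0.
  - by rewrite /line_recip cos0 sin0; lra.
  - by rewrite (line_recip_polar r0 l) invr_gt0.
by rewrite (line_sqdist_polar r0 l) -Kz.
Qed.

Lemma mx_norm_le_enorm z : `|z| <= enorm z.
Proof.
have [z0|/mx_norm_neq0[i zE]] := eqVneq (mx_norm z) 0.
  by rewrite [leLHS]z0 enorm_ge0.
by rewrite [leLHS]zE (ord1 i.1) ler_coord_enorm.
Qed.

Lemma bounded_cone_ball x (M : R) : x != 0 ->
  bounded_set [set v | v != 0 /\ cone_dist x v < M].
Proof.
move=> x0; exists (enorm x * expR M); split; first exact: num_real.
move=> N hN v /= [v0 vM]; rewrite (le_trans (mx_norm_le_enorm v))//.
by rewrite (le_trans _ (ltW hN))//; have /andP[_ /ltW] := enorm_cone_ball x0 v0 vM.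
Qed.

(** A ray leaves the ball, which is open and bounded; after a boundary point it
    has no further one, since all points before a point of the closure are
    interior. *)
Lemma strictly_starlike_cone_ball x (M : R) : x != 0 -> 0 < M ->
  M ^+ 2 <= 1 + q ^+ 2 ->
  strictly_starlike [set v | v != 0 /\ cone_dist x v < M] x.
Proof.
move=> x0 M0 Mq; set D := [set v | _]; split; first exact: bounded_cone_ball.
move=> u u0; have un := enorm_gt0 u0.
have Dx : D x by split=> //; rewrite cone_distxx.
have Dopen z : D z -> interior D z by move=> [z0 zM]; exact: cone_ball_open.
have uniq t1 t2 : 0 <= t1 -> t1 < t2 -> boundary D (x + t1 *: u) ->
    boundary D (x + t2 *: u) -> False.
  move=> t10 t12 [_ nz1] [cz2 _]; apply/nz1/Dopen.
  have t20 := le_lt_trans t10 t12.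
  have [z20 z2M] := closure_cone_ball x0 cz2.
  have z2x : x + t2 *: u != x.
    by rewrite -subr_eq0 addrC addKr scaler_eq0 (gt_eqF t20) (negbTE u0).
  have s01 : 0 <= t1 / t2 < 1.
    by rewrite divr_ge0 ?(ltW t20)//= ltr_pdivrMr// mul1r.
  have z2q : cone_dist x (x + t2 *: u) ^+ 2 <= 1 + q ^+ 2.
    by rewrite (le_trans _ Mq)// ler_sqr ?nnegrE ?cone_dist_ge0 ?(ltW M0).
  have [] := cone_dist_segment_lt x0 z20 z2x z2q s01.
  have -> : (1 - t1 / t2) *: x + (t1 / t2) *: (x + t2 *: u) = x + t1 *: u.
    rewrite scalerDr scalerA divfK ?gt_eqF// addrA -scalerDl subrK scale1r.
    by [].
  by move=> z10 z1M; split; [exact: z10|exact: lt_le_trans z2M].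
pose S := [set t : R | 0 <= t /\ D (x + t *: u)].
have S0 : S 0 by split; rewrite // scale0r addr0.
have Sub : has_ubound S.
  exists ((enorm x * expR M + enorm x) / enorm u) => t [t0 [z0 zM]].
  rewrite ler_pdivlMr//.
  have /andP[_ zn] := enorm_cone_ball x0 z0 zM.
  have -> : t * enorm u = enorm (t *: u) by rewrite enormZ ger0_norm.
  have := enormD (x + t *: u) (- x); rewrite enormN addrC addKr; lra.
have hsup : has_sup S by split; [exists 0|].
pose T := sup S.
have T0 : 0 <= T by apply: ub_le_sup.
have bT : boundary D (x + T *: u).
  split.
    move=> A /nbhs_enormP[e e0 hA].
    have eu : 0 < e / enorm u by rewrite divr_gt0.
    have [t [t0 Dt] Tt] := sup_adherent eu hsup.
    have tT : t <= T := ub_le_sup Sub (conj t0 Dt).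
    exists (x + t *: u); split=> //; apply: hA.
    rewrite opprD addrACA subrr add0r -scalerBl enormZ.
    rewrite -ltr_pdivlMr// distrC ger0_norm ?subr_ge0//.
    by move: Tt; rewrite -/T; lra.
  move=> /nbhs_enormP[e e0 hD].
  pose d := e / 2 / enorm u; have d0 : 0 < d by rewrite !divr_gt0.
  have : S (T + d).
    split; first by rewrite addr_ge0// ltW.
    apply: hD; rewrite opprD addrACA subrr add0r -scalerBl enormZ.
    rewrite (addrC T) addrK gtr0_norm// /d divfK ?gt_eqF//; lra.
  by move=> /(ub_le_sup Sub); rewrite -/T; lra.
have inray t : 0 <= t -> ray x u (x + t *: u).
  by move=> t0; exists t => //=; rewrite in_itv/= t0.
exists (x + T *: u); split; first by split; [exact: inray|].
move=> z [[t /= tT0 <-] bt]; have t0 : 0 <= t by move: tT0; rewrite in_itv/= andbT.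
have [tT|Tt|->//] := ltgtP t T; first by have := uniq _ _ t0 tT bt bT.
by have := uniq _ _ T0 Tt bT bt.
Qed.

Lemma not_starlike_big x (M : R) : x != 0 -> pi < M ->
  ~ starlike [set v : 'rV[R]_n | v != 0 /\ cone_dist x v < M] x.
Proof.
move=> x0 piM /(_ (- x)) h.
have Nx0 : - x != 0 by rewrite oppr_eq0.
have angE : angle x (- x) = pi.
  apply: angle_unique => //; first by rewrite pi_ge0 lexx.
  by rewrite dotNr enormN cospi -sqr_enorm mulrN1 expr2.
have KE : cone_dist x (- x) = pi.
  by rewrite /cone_dist angE enormN subrr expr0n/= addr0 sqrtr_sqr ger0_norm ?pi_ge0.
have : segment x (- x) 0.
  exists (2^-1) => /=; first by rewrite in_itv/=; lra.
  by rewrite scalerN -scalerBl (_ : 1 - 2^-1 - 2^-1 = 0) ?scale0r//; lra.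
have Dx : [set v : 'rV[R]_n | v != 0 /\ cone_dist x v < M] (- x).
  by split=> //; rewrite KE.
by move=> /(h Dx)[]; rewrite eqxx.
Qed.

(** Beyond the point [(-1, sqrt (M ^ 2 - 1))] of the sphere of radius [M] the ray
    from [x] through it returns into the ball. *)
Lemma not_starlike_cone_ball x (M : R) : x != 0 -> 0 <= M ->
  1 + q ^+ 2 < M ^+ 2 ->
  ~ starlike [set v : 'rV[R]_n | v != 0 /\ cone_dist x v < M] x.
Proof.
move=> x0 M0 Mq; have [Mpi|] := leP M pi; last exact: not_starlike_big.
have q5 := q_ge; have q3 := q_le.
pose p2 := Num.sqrt (M ^+ 2 - 1).
have q0 : 0 <= q by lra.
have M21 : 0 <= M ^+ 2 - 1 by have := sqr_ge0 q; lra.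
have p2E : p2 ^+ 2 = M ^+ 2 - 1 by rewrite sqr_sqrtr.
have qp2 : q < p2 by rewrite -ltr_sqr ?nnegrE ?sqrtr_ge0// p2E; lra.
have p20 : 0 < p2 by lra.
have p2pi : p2 < pi.
  have : M ^+ 2 <= pi ^+ 2 by rewrite ler_sqr ?nnegrE ?pi_ge0.
  by rewrite -ltr_sqr ?nnegrE ?(ltW p20) ?pi_ge0// p2E; lra.
have sp2 : 0 < sin p2 by rewrite sin_gt0_pi// p20.
clearbody p2; pose B := (expR 1 - cos p2) / sin p2.
have hp2 : line_recip 1 B p2 = expR 1.
  by rewrite /line_recip /B divfK ?gt_eqF// mul1r addrC subrK.
clearbody B; have hp20 : 0 < line_recip 1 B p2 by rewrite hp2 expR_gt0.
have FM : line_sqdist 1 B p2 = M ^+ 2.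
  by rewrite /line_sqdist hp2 expRK expr1n p2E addrC subrK.
have F'0 : line_sqdist' 1 B p2 < 0.
  have := tangency_lt q_ge qE qp2 (ltW p2pi).
  have := star_line hp20; rewrite hp2 expRK /star /tangency => e1 e2.
  have : sin p2 * line_sqdist' 1 B p2 / 2 < 0 by rewrite -e1; lra.
  by rewrite pmulr_llt0 ?invr_gt0// pmulr_rlt0.
have [p3 [p23 p3pi hp30 Fp3]] : exists p3, [/\ p2 < p3, p3 < pi,
    0 < line_recip 1 B p3 & line_sqdist 1 B p3 < M ^+ 2].
  have dN := is_deriveN (is_derive_line_sqdist hp20).
  have NF'0 : 0 < - line_sqdist' 1 B p2 by rewrite oppr_gt0.
  have [_ nF] := is_derive_gt0_near dN NF'0.
  have ch : line_recip 1 B y @[y --> p2] --> line_recip 1 B p2.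
    apply: differentiable_continuous; apply/derivable1_diffP.
    by case: (is_derive_line_recip 1 B p2).
  have nh : \forall y \near p2^'+, 0 < line_recip 1 B y.
    by rewrite near_withinE; apply: filterS (cvgr_gt _ ch _ hp20) => y.
  suff /filter_ex[y [? ? ? ?]] : \forall y \near p2^'+, [/\ p2 < y, y < pi,
      0 < line_recip 1 B y & line_sqdist 1 B y < M ^+ 2] by exists y.
  near=> y; split.
  - by near: y; exact: nbhs_right_gt.
  - by near: y; exact: nbhs_right_lt.
  - by near: y; exact: nh.
  - rewrite -FM -ltrN2; near: y; exact: nF.
pose r2 := (line_recip 1 B p2)^-1; pose r3 := (line_recip 1 B p3)^-1.
have r20 : 0 < r2 by rewrite invr_gt0.
have r30 : 0 < r3 by rewrite invr_gt0.
have lE r p : 1 * (r * cos p) + B * (r * sin p) = r * line_recip 1 B p.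
  by rewrite /line_recip; ring.
have l2 : 1 * (r2 * cos p2) + B * (r2 * sin p2) = 1.
  by rewrite lE mulVf// gt_eqF.
have l3 : 1 * (r3 * cos p3) + B * (r3 * sin p3) = 1.
  by rewrite lE mulVf// gt_eqF.
have u2 : r2 * cos p2 = 1 - B * (r2 * sin p2).
  by rewrite -l2 mul1r addrK.
have u3 : r3 * cos p3 = 1 - B * (r3 * sin p3).
  by rewrite -l3 mul1r addrK.
have F2 := line_sqdist_polar r20 l2; have F3 := line_sqdist_polar r30 l3.
clearbody r2 r3.
have p30 : 0 < p3 by lra.
have sp3 : 0 < sin p3 by rewrite sin_gt0_pi// p30.
have [e1 [e2 [e12 xE _]]] := polar_frame n2 x0 x0.
have X0 := enorm_gt0 x0; set X := enorm x in X0 xE.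
have r3X : 0 < X * r3 by exact: mulr_gt0.
have pb t : 0 < t -> t < pi -> 0 <= t <= pi by move=> t0 tpi; rewrite !ltW.
have K2 : cone_dist x (polar e1 e2 (X * r2) p2) = M.
  apply/eqP; rewrite -(@eqrXn2 _ 2) ?cone_dist_ge0// {1}xE cone_dist_polar ?pb//.
  by rewrite -F2 FM.
have K3 : cone_dist x (polar e1 e2 (X * r3) p3) < M.
  rewrite -ltr_sqr ?nnegrE ?cone_dist_ge0// {1}xE cone_dist_polar ?pb//.
  by rewrite -F3.
have D3 : [set v : 'rV[R]_n | v != 0 /\ cone_dist x v < M] (polar e1 e2 (X * r3) p3).
  by split=> //; exact: polar_neq0.
move=> /(_ _ D3 (polar e1 e2 (X * r2) p2)) h.
suff /h[_] : segment x (polar e1 e2 (X * r3) p3) (polar e1 e2 (X * r2) p2).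
  by rewrite K2 ltxx.
have v20 : 0 < r2 * sin p2 by exact: mulr_gt0.
have v30 : 0 < r3 * sin p3 by exact: mulr_gt0.
pose s := r2 * sin p2 / (r3 * sin p3).
have sE : s * (r3 * sin p3) = r2 * sin p2 by rewrite /s divfK ?gt_eqF.
have s23 : r2 * sin p2 <= r3 * sin p3.
  have : 0 < r2 * r3 * sin (p3 - p2).
    apply: mulr_gt0; first exact: mulr_gt0.
    by rewrite sin_gt0_pi// subr_gt0 p23 ltrBlDr ltr_wpDr ?(ltW p20).
  rewrite polar_sin_sub.
  by rewrite u2 u3; clear; lra.
exists s.
  rewrite /= in_itv/= divr_ge0 ?(ltW v20) ?(ltW v30)//=.
  by rewrite ler_pdivrMr// mul1r.
rewrite {1}xE; apply/esym/polar_conv; last by rewrite sE.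
by rewrite u3 mulrBr mulr1 (mulrCA s) sE u2; clear; ring.
Unshelve. all: by end_near. Qed.

End starlikeness.


(** * Failure of convexity for radius above 1 *)

Section nonconvexity.
Context {R : realType} {n : nat}.
Hypothesis n2 : (2 <= n)%N.
Implicit Types x y z : 'rV[R]_n.

Lemma cos_le_gauss (t : R) : 0 <= t -> t <= 1 -> cos t <= expR (- (t ^+ 2 / 2)).
Proof.
move=> t0 t1; have pi3 := @pi_gt3 R.
have dE (s : R) : is_derive s (1 : R) (fun s => expR (s ^+ 2 / 2)) (expR (s ^+ 2 / 2) * s).
  have dsq : is_derive s (1 : R) (fun s => s ^+ 2 / 2) s.
    by apply: is_derive_eq; rewrite /GRing.scale/=; field.
  exact: (@is_derive1_comp _ expR (fun s => s ^+ 2 / 2)).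
have df (s : R) : is_derive s (1 : R) (fun s => - (cos s * expR (s ^+ 2 / 2)))
    (expR (s ^+ 2 / 2) * (sin s - s * cos s)).
  have := dE s => ?.
  by apply: is_derive_eq; rewrite /GRing.scale/=; ring.
have := is_derive_le t0 (fun s _ => df s).
rewrite cos0 expr0n mul0r expR0 mulr1 lerN2 expRN => h.
rewrite -[leLHS](mulfK (_ : expR (t ^+ 2 / 2) != 0)) ?gt_eqF ?expR_gt0//.
rewrite -[leRHS]mul1r ler_wpM2r ?invr_ge0 ?expR_ge0//.
apply: h => s /andP[s0 st]; rewrite mulr_ge0 ?expR_ge0// subr_ge0.
by rewrite mulr_cos_le_sin//; lra.
Qed.

Lemma gauss_le_cos (t : R) : 0 <= t -> t <= 1 -> expR (- t ^+ 2) <= cos t.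
Proof.
move=> t0 t1; apply: le_trans (cos_ge_quadratic t).
have t2 : 0 <= t ^+ 2 by exact: sqr_ge0.
have t21 : t ^+ 2 <= 1 by rewrite expr_le1.
have := expRN_taylor 3 t2; cbv [expN_sum monomial].
have : t ^+ 2 * t ^+ 2 <= t ^+ 2 by rewrite ler_piMl.
by move: (expR _) => E; lra.
Qed.

(** At the point of the sphere of radius [M] next to the origin the second
    derivative [2 * (1 + l'^2) * (1 - M)] along the tangent is negative. *)
Lemma cone_ball_not_convex x (M : R) : x != 0 -> 1 < M ->
  exists a b : 'rV[R]_n, [/\ a != 0 /\ cone_dist x a < M,
    b != 0 /\ cone_dist x b < M &
    ~ cone_dist x (2^-1 *: a + 2^-1 *: b) < M].
Proof.
move=> x0 M1; have [e1 [e2 [e12 xE _]]] := polar_frame n2 x0 x0.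
have X0 := enorm_gt0 x0; set X := enorm x in X0 xE.
have e12' : orthonormal2 e1 (- e2).
  by case: e12 => e11 e22 e1e2; split; rewrite // !dotE ?opprK// e1e2 oppr0.
have xE' : x = polar e1 (- e2) X 0.
  by rewrite xE /polar sin0 !scale0r.
have pi3 := @pi_gt3 R.
pose k := Num.min (M - 1) 1.
have k0 : 0 < k by rewrite lt_min ltr01 andbT subr_gt0.
have k1 : k <= 1 by rewrite ge_min lexx orbT.
have kM : k <= M - 1 by rewrite ge_min lexx.
pose t := k / 2; have t0 : 0 < t by rewrite divr_gt0.
have t1 : t <= 1 by rewrite /t; lra.
have t2M : t ^+ 2 < M - 1.
  apply: lt_le_trans kM; rewrite /t expr_div_n.
  have : k ^+ 2 <= k by rewrite expr2 ler_piMl// ltW.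
  by lra.
clearbody t; have ct : 0 < cos t by rewrite cos_gt0_pihalf//; lra.
pose r := expR (- M) / cos t; have r0 : 0 < r by rewrite divr_gt0 ?expR_gt0.
have tpi : 0 <= t <= pi by lra.
have small : polar_sqdist r t < M ^+ 2.
  have lnr : ln r = - M - ln (cos t) by rewrite ln_div ?posrE ?expR_gt0// expRK.
  have l1 : ln (cos t) <= - (t ^+ 2 / 2).
    by rewrite -ler_expR lnK ?posrE// cos_le_gauss// ltW.
  have l2 : - t ^+ 2 <= ln (cos t).
    by rewrite -ler_expR lnK ?posrE// gauss_le_cos// ltW.
  rewrite /polar_sqdist lnr; move: (ln (cos t)) l1 l2 => y y1 y2.
  have : y ^+ 2 <= t ^+ 2 * t ^+ 2.
    have -> : y ^+ 2 = (- y) * (- y) by ring.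
    have t20 := sqr_ge0 t.
    by apply: ler_pM; lra.
  have : M * y <= M * - (t ^+ 2 / 2) by rewrite ler_wpM2l//; lra.
  have : t ^+ 2 * t ^+ 2 < t ^+ 2 * (M - 1) by rewrite ltr_pM2l// exprn_gt0.
  by lra.
have Xr : 0 < X * r by exact: mulr_gt0.
have M0 : 0 <= M by lra.
exists (polar e1 e2 (X * r) t), (polar e1 (- e2) (X * r) t); split.
- split; first exact: polar_neq0.
  by rewrite -ltr_sqr ?nnegrE ?cone_dist_ge0// {1}xE cone_dist_polar.
- split; first exact: polar_neq0.
  by rewrite -ltr_sqr ?nnegrE ?cone_dist_ge0// {1}xE' cone_dist_polar.
have -> : 2^-1 *: polar e1 e2 (X * r) t + 2^-1 *: polar e1 (- e2) (X * r) t =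
    expR (- M) *: x.
  rewrite [in RHS]xE; apply/rowP => i; rewrite !mxE cos0 sin0 /r.
  by field; rewrite gt_eqF.
apply/negP; rewrite -leNgt; apply: le_trans (ln_le_cone_dist _ _).
rewrite enormZ (gtr0_norm (expR_gt0 _)) lnM ?posrE ?expR_gt0 ?enorm_gt0// expRK.
by rewrite (le_trans _ (ler_norm _))//; lra.
Qed.

End nonconvexity.
(** * Convexity and starlikeness of quasihyperbolic balls *)

Theorem theorem1p1 (R : realType) (n : nat) (hn : (2 <= n)%N) :
  exists kappa : R,
    [/\ 1 <= kappa <= pi /\ kappa_equation kappa,
        forall p : R, 1 <= p <= pi -> kappa_equation p -> p = kappa,
        `|kappa - (2 + 83 / 10 ^+ 2 + 297 / 10 ^+ 5)| <= 5 / 10 ^+ 6,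
        forall x : 'rV[R]_n, x != 0 ->
          (forall M : R, 0 < M <= 1 ->
             strictly_convex (qh_ball [set~ 0] x M)) /\
          (forall M : R, 1 < M ->
             ~ convex_set
                 (qh_ball [set~ 0] x M : set (convex_lmodType 'rV[R]_n)))
      & forall x : 'rV[R]_n, x != 0 ->
          (forall M : R, 0 < M <= kappa ->
             strictly_starlike (qh_ball [set~ 0] x M) x) /\
          (forall M : R, kappa < M ->
             ~ starlike (qh_ball [set~ 0] x M) x)].
Proof.
have [q [q_lo q_hi qE]] := exists_tangency (R := R).
have q_ge : 5 / 2 <= q by lra.
have q_le : q <= 27 / 10 by lra.
have pi3 := @pi_gt3 R.
have q0 : 0 <= q by lra.
pose kappa := Num.sqrt (1 + q ^+ 2).
have k0 : 0 <= kappa by exact: sqrtr_ge0.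
have q2 := sqr_ge0 q.
have k2 : kappa ^+ 2 = 1 + q ^+ 2 by rewrite sqr_sqrtr//; lra.
have kE : Num.sqrt (kappa ^+ 2 - 1) = q.
  by rewrite k2 addrAC subrr add0r sqrtr_sqr ger0_norm.
have sqr_le (a b : R) : 0 <= a -> a <= b -> a ^+ 2 <= b ^+ 2.
  by move=> a0 ab; rewrite ler_sqr ?nnegrE// (le_trans a0).
have q2_lo : (2 + 650 / 10 ^+ 3 + 605 / 10 ^+ 6) ^+ 2 <= q ^+ 2.
  by apply: sqr_le q_lo; lra.
have q2_hi := sqr_le _ _ q0 q_hi.
have k_ge c : 0 <= c -> c ^+ 2 <= 1 + q ^+ 2 -> c <= kappa.
  by move=> c0; rewrite -k2 ler_sqr ?nnegrE.
have k_le c : 0 <= c -> 1 + q ^+ 2 <= c ^+ 2 -> kappa <= c.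
  by move=> c0; rewrite -k2 ler_sqr ?nnegrE.
have klo : 2 + 83 / 10 ^+ 2 + 296 / 10 ^+ 5 + 5 / 10 ^+ 6 <= kappa.
  apply: k_ge; first by lra.
  by move: (q ^+ 2) q2_lo => w; lra.
have khi : kappa <= 2 + 83 / 10 ^+ 2 + 297 / 10 ^+ 5 + 5 / 10 ^+ 6.
  apply: k_le; first by lra.
  by move: (q ^+ 2) q2_hi => w; lra.
clear q_lo q_hi q2_lo q2_hi k_ge k_le; exists kappa; split.
- by split; [lra|rewrite /kappa_equation kE].
- move=> p /andP[p1 ppi]; rewrite /kappa_equation.
  have p21 : 0 <= p ^+ 2 - 1 by rewrite subr_ge0 expr_ge1//; lra.
  set s := Num.sqrt (p ^+ 2 - 1) => sE.
  have s0 : 0 <= s by exact: sqrtr_ge0.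
  have s2 : s ^+ 2 = p ^+ 2 - 1 by rewrite sqr_sqrtr.
  have spi : s <= pi.
    rewrite -ler_sqr ?nnegrE ?pi_ge0// s2.
    have : p ^+ 2 <= pi ^+ 2 by rewrite ler_sqr ?nnegrE ?pi_ge0//; lra.
    by lra.
  have sq : s = q.
    case: (ltgtP s q) => // [sq|qs].
      have := tangency_gt q_le qE s0 sq; rewrite /tangency sE ltxx.
      by [].
    by have := tangency_lt q_ge qE qs spi; rewrite /tangency sE ltxx.
  apply/eqP; rewrite -(@eqrXn2 _ 2)//; last by lra.
  by rewrite k2 -sq s2; apply/eqP; ring.
- by rewrite ler_norml; lra.
- move=> x x0; split=> M; rewrite (qh_ballE hn)//.
    move=> /andP[M0 M1] a b.
    move=> /(closure_cone_ball x0)[a0 aM] /(closure_cone_ball x0)[b0 bM].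
    move=> /eqP ab t t01.
    have [c0 cM] := cone_dist_strictly_convex x0 a0 b0 M1 aM bM ab t01.
    exact: cone_ball_open.
  move=> M1 cvx; have [a [b [Da Db]]] := cone_ball_not_convex hn x0 M1.
  have -> : 2^-1 *: a + 2^-1 *: b = 2^-1 *: a + (1 - 2^-1) *: b.
    by congr (_ + _ *: _); lra.
  have half0 : 0 <= 2^-1 :> R by rewrite invr_ge0 ler0n.
  have half1 : 2^-1 <= 1 :> R by rewrite invf_le1 ?ler1n ?ltr0n.
  move=> notD; apply: notD.
  by case: (set_mem (cvx a b (Itv01 half0 half1) (mem_set Da) (mem_set Db))).
- move=> x x0; split=> M; rewrite (qh_ballE hn)//.
    move=> /andP[M0 Mk]; apply: (strictly_starlike_cone_ball hn q_ge q_le qE) => //.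
    by rewrite -k2 ler_sqr ?nnegrE// ltW.
  move=> kM; have M0 : 0 <= M by rewrite (le_trans k0)// ltW.
  apply: (not_starlike_cone_ball hn q_ge q_le qE) => //.
  by rewrite -k2 ltr_sqr ?nnegrE.
Qed.
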